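(* Let $U,V\subset(0,\infty)$ be two non-empty open sets and let $f\colon(0,\infty)\to\mathbb{R}$ be continuous such that $(f(ku+v))_{k\ge1}\in\mathcal{G}$ for all $u\in U$ and $v\in V$. Then there exists an interval $J\subset(0,\infty)$ of positive length such that the restriction of $f$ to $J$ is a polynomial.
   Context: A sequence of real numbers $(a_k)_{k\ge1}$ is called pointwise good (written $(a_k)\in\mathcal{G}$) if for every measure preserving flow $(U_t)_{t\in\mathbb{R}}$ on a probability space $(X,\mathcal{B},\mu)$ (a measurable action of $\mathbb{R}$ by measure preserving transformations) and every $F\in L^\infty(X,\mu)$, the averages $\frac1n\sum_{k=1}^n F(U_{a_k}x)$ converge for $\mu$-almost every $x$ as $n\to\infty$. *)

(* Defs.v *)
From Stdlib Require Import Reals.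
Open Scope R_scope.

Definition is_sigma_algebra {X : Type} (S : (X -> Prop) -> Prop) : Prop :=
  S (fun _ => True) /\
  (forall A, S A -> S (fun x => ~ A x)) /\
  (forall A : nat -> X -> Prop, (forall n, S (A n)) -> S (fun x => exists n, A n x)).

Definition generated {X : Type} (G : (X -> Prop) -> Prop) (A : X -> Prop) : Prop :=
  forall S, is_sigma_algebra S -> (forall B, G B -> S B) -> S A.

Definition borel : (R -> Prop) -> Prop :=
  generated (fun B => exists a b, forall x, B x <-> a < x < b).

Definition prod_sigma {Y Z : Type} (SY : (Y -> Prop) -> Prop) (SZ : (Z -> Prop) -> Prop)
  : (Y * Z -> Prop) -> Prop :=
  generated (fun C => exists A B, SY A /\ SZ B /\ forall p, C p <-> (A (fst p) /\ B (snd p))).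

Definition measurable_fun {Y Z : Type} (SY : (Y -> Prop) -> Prop) (SZ : (Z -> Prop) -> Prop)
  (g : Y -> Z) : Prop :=
  forall B, SZ B -> SY (fun y => B (g y)).

Definition is_probability_space {X : Type} (S : (X -> Prop) -> Prop) (mu : (X -> Prop) -> R) : Prop :=
  is_sigma_algebra S /\
  (forall A, S A -> 0 <= mu A) /\
  mu (fun _ => True) = 1 /\
  (forall A : nat -> X -> Prop,
     (forall n, S (A n)) ->
     (forall n m x, n <> m -> A n x -> A m x -> False) ->
     infinite_sum (fun n => mu (A n)) (mu (fun x => exists n, A n x))).

Definition is_mp_flow {X : Type} (S : (X -> Prop) -> Prop) (mu : (X -> Prop) -> R)
  (U : R -> X -> X) : Prop :=
  (forall x, U 0 x = x) /\
  (forall s t x, U (s + t) x = U s (U t x)) /\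
  measurable_fun (prod_sigma borel S) S (fun p => U (fst p) (snd p)) /\
  (forall t, measurable_fun S S (U t)) /\
  (forall t A, S A -> mu (fun x => A (U t x)) = mu A).

Definition is_Linfty {X : Type} (S : (X -> Prop) -> Prop) (mu : (X -> Prop) -> R)
  (F : X -> R) : Prop :=
  measurable_fun S borel F /\
  exists M N, S N /\ mu N = 0 /\ forall x, ~ N x -> Rabs (F x) <= M.

(** ergodic average (1/n) sum_{k=1}^n F(U_{a_k} x), indexed here by n+1 *)
Definition avg {X : Type} (U : R -> X -> X) (F : X -> R) (a : nat -> R) (x : X) (n : nat) : R :=
  sum_f_R0 (fun j => F (U (a (S j)) x)) n / INR (S n).

(** the class G of pointwise good sequences (a_k)_{k >= 1}; a 0 is unused *)
Definition pointwise_good (a : nat -> R) : Prop :=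
  forall (X : Type) (S : (X -> Prop) -> Prop) (mu : (X -> Prop) -> R) (U : R -> X -> X) (F : X -> R),
    is_probability_space S mu -> is_mp_flow S mu U -> is_Linfty S mu F ->
    exists N, S N /\ mu N = 0 /\
      forall x, ~ N x -> exists l, Un_cv (avg U F a x) l.

(* Main.v *)
(* If, for some integers c_k not all zero, sum_k c_k f(k u + v) vanishes on an open
   set of (u, v), then taking differences along directions that fix one of the
   arguments k u + v eliminates the other terms one at a time: some iterated difference
   of f vanishes locally, and a continuous f with that property is a polynomial.
   Otherwise Baire's theorem yields u, v and a period w such that w, f(u + v),
   f(2 u + v), ... are linearly independent over Q.  By Kronecker's theorem there are
   then integers m for which the numbers m f(k u + v) / w, taken mod 1, stay close to
   the phase j / (3 L) while k runs through the j-th of 3 L long consecutive blocks.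
   Under the flow x + t / w on the circle, every point therefore spends almost all of
   some block in the set of measure at most 1 / L where m x is within O(1 / L) of an
   integer.  A union of such sets has measure at most 1/4 while the averages of its
   indicator have upper limit 1 everywhere; if these averages converged almost
   everywhere, this would contradict Markov's inequality. *)
Require Import Defs.
From Stdlib Require Import Reals Lra Lia.
From mathcomp Require Import all_boot all_order all_algebra zify.
From mathcomp Require Import boolp classical_sets reals ereal.
From mathcomp Require Import normedtype measure lebesgue_measure measurable_realfun Rstruct_topology.
Import Order.TTheory GRing.Theory Num.Theory numFieldNormedType.Exports.
Set Implicit Arguments.
Unset Strict Implicit.
Unset Printing Implicit Defensive.

(** * Lebesgue measure on the circle *)

Section CircleMeasure.
Local Open Scope ring_scope.
Local Open Scope classical_set_scope.
Context {R : realType}.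
Notation mR := (measurableTypeR R).

Definition borel_set (A : set R) : Prop := @measurable _ mR A.

(** Haar measure of R/Z for a 1-periodic set, computed on the fundamental domain [0, 1). *)
Definition circle_mu (A : set R) : R :=
  fine (lebesgue_measure (A `&` `[0, 1[ : set mR)).

Lemma measurable_shift (s : R) : measurable_fun setT (fun x : mR => x + s : mR).
Proof. by apply: measurable_funD => //; exact: measurable_cst. Qed.

(** The pushforward along a translation preserves the lengths of half-open intervals, and these
    determine Lebesgue measure. *)
Lemma lebesgue_measure_shift (s : R) (A : set R) : borel_set A ->
  lebesgue_measure ((fun x => x + s) @^-1` A : set mR) = lebesgue_measure (A : set mR).
Proof.
move=> mA.
transitivity (pushforward (@lebesgue_measure R) (fun x : mR => x + s : mR) A); first by [].
apply/esym/lebesgue_measure_unique => //=; first exact: measurable_shift.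
move=> ms _ [[a b]] _ <-; rewrite /pushforward.
have -> : (fun x : R => x + s) @^-1` `]a, b] = `]a - s, b - s].
  by apply/seteqP; split => x /=; rewrite !in_itv /= ltrBlDr lerBrDr.
rewrite !lebesgue_measure_itv /= !lte_fin ltrD2r.
by case: ifP => // _; rewrite -!EFinB opprD addrACA subrr addr0.
Qed.

Lemma periodic_int (A : set R) (z : int) (x : R) :
  (forall x, A (x + 1) <-> A x) -> A (x + z%:~R) <-> A x.
Proof.
move=> pA.
have pn (n : nat) y : A (y + n%:R) <-> A y.
  elim: n y => [|n IH] y; first by rewrite addr0.
  by rewrite -natr1 addrA pA.
case: z => n; first exact: pn.
by rewrite NegzE mulrNz -(pn n.+1 (x - _)) -addrA pmulrn addNr addr0.
Qed.

(** By periodicity only the fractional part [t] of [s] matters. Translation by [t] exchanges two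
    arcs: [0, 1 - t) goes to [t, 1), and [1 - t, 1) wraps around to [0, t). *)
Lemma circle_mu_shift (s : R) (A : set R) : borel_set A ->
  (forall x, A (x + 1) <-> A x) -> circle_mu ((fun x => x + s) @^-1` A) = circle_mu A.
Proof.
move=> mA pA; rewrite /circle_mu; congr fine.
pose t := s - (Num.floor s)%:~R.
have t0 : 0 <= t by rewrite subr_ge0 floor_le.
have t1 : t < 1 by rewrite ltrBlDl -[X in _ + X]/(1%:~R) -intrD floorD1_gt.
have -> : (fun x => x + s) @^-1` A = (fun x => x + t) @^-1` A.
  have e x : A (x + t) <-> A (x + s) by rewrite /t addrA -mulrNz; exact: periodic_int.
  by apply/seteqP; split => x /e.
have mi a b : borel_set `[a, b[ by exact: measurable_itv.
have mI (C D : set R) : borel_set C -> borel_set D -> borel_set (C `&` D) by exact: measurableI.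
have ms u C : borel_set C -> borel_set ((fun x => x + u) @^-1` C).
  by move=> mC; rewrite -[X in borel_set X]setTI; exact: measurable_shift.
have -> : (fun x => x + t) @^-1` A `&` `[0, 1[ =
   ((fun x => x + t) @^-1` (A `&` `[t, 1[)) `|` ((fun x => x + (t - 1)) @^-1` (A `&` `[0, t[)).
  apply/seteqP; split => x /=; rewrite !in_itv /=.
    case=> Ax /andP[x0 x1]; have [h|h] := ltP (x + t) 1.
      by left; rewrite lerDr x0.
    right; rewrite addrA -pA subrK subr_ge0 h; split => //.
    by rewrite ltrBlDr addrC ltrD2l.
  case=> [[Ax /andP[x0 x1]]|].
    split=> //; move: x0; rewrite lerDr => -> /=; apply: le_lt_trans x1; by rewrite lerDl.
  case; rewrite addrA -pA subrK => Ax /andP[x0 x1]; split => //.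
  apply/andP; split; last by move: x1; rewrite ltrBlDr addrC ltrD2l.
  by move: x0; rewrite subr_ge0 => x0; rewrite -(lerD2r t) add0r (le_trans (ltW t1)).
have -> : A `&` `[0, 1[ = (A `&` `[t, 1[) `|` (A `&` `[0, t[).
  apply/seteqP; split => x /=; rewrite !in_itv /=.
    case=> Ax /andP[x0 x1]; have [h|h] := ltP x t; first by right; rewrite x0.
    by left; rewrite x1.
  case=> -[Ax /andP[x0 x1]]; split => //.
    by rewrite x1 (le_trans t0 x0).
  by rewrite x0 (lt_trans x1 t1).
rewrite !measureU //; try exact: mI; try by apply: ms; exact: mI.
- by congr (_ + _); apply: lebesgue_measure_shift; exact: mI.
- apply/seteqP; split => x //= -[[_]]; rewrite !in_itv /= => /andP[h _] [_] /andP[_].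
  by rewrite ltNge h.
- apply/seteqP; split => x //= -[[_]]; rewrite !in_itv /= => /andP[_ h] [_] /andP[].
  by rewrite addrA subr_ge0 leNgt h.
Qed.

Lemma circle_mu_ge0 (A : set R) : 0 <= circle_mu A.
Proof. exact/fine_ge0/measure_ge0. Qed.

Lemma circle_muT : circle_mu setT = 1.
Proof.
by rewrite /circle_mu setTI lebesgue_measure_itv /= lte_fin ltr01 /= subr0.
Qed.

(** Countable additivity in the epsilon form of [infinite_sum]; all measures involved are finite, so
    it carries over from the extended reals. *)
Lemma circle_mu_sigma (F : nat -> set R) : (forall n, borel_set (F n)) ->
  (forall n m x, n <> m -> F n x -> F m x -> False) ->
  forall e, 0 < e -> exists N, forall n, (N <= n)%N ->
    `|circle_mu (\bigcup_n F n) - \sum_(0 <= i < n) circle_mu (F i)| < e.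
Proof.
move=> mF tF e e0.
have mi : borel_set `[0, 1[ by exact: measurable_itv.
have mI (C D : set R) : borel_set C -> borel_set D -> borel_set (C `&` D) by exact: measurableI.
have finE (C : set R) : borel_set C ->
   lebesgue_measure (C `&` `[0, 1[ : set mR) = (circle_mu C)%:E.
  move=> mC; rewrite /circle_mu fineK // ge0_fin_numE //.
  apply: (@le_lt_trans _ _ (lebesgue_measure (`[0%R, 1%R[ : set mR))).
    by apply: le_measure; rewrite ?inE //; exact: mI.
  by rewrite lebesgue_measure_itv /= lte_fin ltr01 -EFinB ltry.
have mUF : borel_set (\bigcup_n F n) by exact: bigcupT_measurable.
pose G n : set mR := F n `&` `[0, 1[.
have mG n : borel_set (G n) by exact: mI.
have GE : \bigcup_n G n = (\bigcup_n F n) `&` `[0, 1[ by rewrite setI_bigcupl.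
have cv : (\sum_(0 <= i < n) lebesgue_measure (G i))%E @[n --> \oo]
    --> (circle_mu (\bigcup_n F n))%:E.
  rewrite -finE // -GE; apply: measure_semi_sigma_additive => //.
    apply/trivIsetP => i j _ _ /eqP ij; apply/seteqP; split => x // [[Fi _] [Fj _]].
    exact: (tF i j x).
  by rewrite GE; apply: mI.
have {}cv : \sum_(0 <= i < n) circle_mu (F i) @[n --> \oo] --> circle_mu (\bigcup_n F n).
  rewrite [X in X @ _](_ : _ = fine \o (fun n => \sum_(0 <= i < n) lebesgue_measure (G i))%E).
    exact: fine_cvg cv.
  apply/funext => n /=.
  rewrite (eq_bigr (fun i => (circle_mu (F i))%:E)); last by move=> i _; rewrite finE.
  by rewrite sumEFin.
move/cvgrPdist_lt/(_ e e0): cv => [N _ hN].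
by exists N => n nN; exact: hN.
Qed.
End CircleMeasure.

Local Delimit Scope Z_scope with Z.
Local Open Scope R_scope.

(** * Kronecker's theorem *)

(** Linear independence over Q of [b 0], ..., [b n]; integer coefficients suffice after clearing
    denominators. *)
Definition rat_free (b : nat -> R) (n : nat) : Prop :=
  forall c : nat -> Z, sum_f_R0 (fun k => IZR (c k) * b k) n = 0 ->
  forall k, (k <= n)%N -> c k = 0%Z.

(** Pigeonhole: the N + 1 fractional parts of 0, x, ..., N x fall into N cells of length 1 / N, so
    two share a cell, and [q] is the difference of their indices. *)
Lemma dirichlet_approx (x : R) (N : nat) : (0 < N)%N ->
  exists (q : nat) (p : Z),
   (0 < q <= N)%N /\ Rabs (INR q * x - IZR p) < / INR N.
Proof.
move=> N0.
have N0' : 0 < INR N by apply: lt_0_INR; lia.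
have [fl flP] : exists fl : R -> Z, forall y, IZR (fl y) <= y < IZR (fl y) + 1.
  exists (fun y => (up y - 1)%Z) => y; have [h1 h2] := archimed y.
  rewrite minus_IZR; lra.
pose fr (i : nat) := INR i * x - IZR (fl (INR i * x)).
have frP i : 0 <= fr i < 1 by rewrite /fr; have := flP (INR i * x); lra.
pose cl i := fl (fr i * INR N).
have cellP i : (Z.to_nat (cl i) < N)%N.
  rewrite /cl.
  have h := flP (fr i * INR N); have h' := frP i.
  have: IZR (fl (fr i * INR N)) < IZR (Z.of_nat N) by rewrite -INR_IZR_INZ; nra.
  by move/lt_IZR; lia.
pose cell (i : 'I_N.+1) : 'I_N := Ordinal (cellP i).
have : ~~ injectiveb cell.
  apply/injectiveP => /leq_card; rewrite !card_ord; lia.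
case/injectivePn => i [j ij].
wlog lij : i j ij / (i < j)%N => [hw|].
  move=> e; case: (ltngtP i j) => [h|h|h].
  - exact: (hw i j).
  - by apply: (hw j i) => //; rewrite eq_sym.
  - by move/val_inj: h ij => ->; rewrite eqxx.
move/(congr1 val) => /= e.
have e' : fl (fr i * INR N) = fl (fr j * INR N).
  have pos k : (0 <= cl k)%Z.
    suff: (-1 < cl k)%Z by lia.
    apply: lt_IZR; rewrite /cl; have := flP (fr k * INR N); have := frP k; nra.
  have := pos i; have := pos j; rewrite /cl in e *; lia.
exists (j - i)%N, (Z.sub (fl (INR j * x)) (fl (INR i * x))); split.
  by have := ltn_ord j; lia.
rewrite minus_INR ?minus_IZR; last lia.
have -> : (INR j - INR i) * x - (IZR (fl (INR j * x)) - IZR (fl (INR i * x)))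
   = fr j - fr i by rewrite /fr; ring.
have h1 := flP (fr i * INR N); have h2 := flP (fr j * INR N); rewrite e' in h1.
have NN : INR N * / INR N = 1 by apply: Rinv_r; lra.
have iN : 0 < / INR N by apply: Rinv_0_lt_compat.
apply: Rabs_def1; nra.
Qed.

Lemma small_inv (eps : R) : 0 < eps -> exists N : nat, 0 < / INR N.+1 < eps.
Proof.
move=> e0; have [[|N] [h1 h2]] := archimed_cor1 eps e0; first lia.
by exists N; split => //; apply: Rinv_0_lt_compat; apply: lt_0_INR; lia.
Qed.

(** Induction on [n]: the first [n] numbers are approximated to within eps / N, which leaves room to
    multiply the denominator by some j <= N that serves the last one. *)
Lemma dirichlet_simultaneous (x : nat -> R) (n : nat) (eps : R) : 0 < eps ->
  exists (q : nat) (p : nat -> Z), (0 < q)%N /\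
   forall k, (k < n)%N -> Rabs (INR q * x k - IZR (p k)) < eps.
Proof.
elim: n eps => [|n IH] eps e0; first by exists 1%N, (fun=> 0%Z).
have [N' [iN Ne]] := small_inv e0.
set N := N'.+1 in iN Ne; have N0 : (0 < N)%N by [].
have N0' : 0 < INR N by apply: lt_0_INR; lia.
have NN : INR N * / INR N = 1 by apply: Rinv_r; lra.
have [|q [p [q0 hp]]] := IH (eps * / INR N); first nra.
have [j [r [/andP[j0 jN] hr]]] := dirichlet_approx (INR q * x n) N0.
exists (j * q)%N, (fun k => if k == n then r else (Z.of_nat j * p k)%Z); split; first lia.
have jN' : 0 < INR j <= INR N by split; [apply: lt_0_INR; lia | apply: le_INR; lia].
move=> k; rewrite ltnS leq_eqVlt mult_INR; case: eqP => [-> _|_ /= kn].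
  by rewrite Rmult_assoc; lra.
rewrite mult_IZR -INR_IZR_INZ.
have -> : INR j * INR q * x k - INR j * IZR (p k) = INR j * (INR q * x k - IZR (p k)) by ring.
rewrite Rabs_mult (Rabs_pos_eq (INR j)); last lra.
have := hp k kn; have := Rabs_pos (INR q * x k - IZR (p k)).
move: (Rabs _) => z z0 hz.
have : INR j * z <= INR N * z by nra.
have : INR N * z < INR N * (eps * / INR N) by nra.
nra.
Qed.

Lemma sum_IZR (c : nat -> Z) n : exists z, sum_f_R0 (fun k => IZR (c k)) n = IZR z.
Proof.
elim: n => [|n [z hz]]; first by exists (c 0%N).
by exists (z + c n.+1)%Z; rewrite /= hz plus_IZR.
Qed.

Lemma rat_free_neq0 b n : rat_free b n -> b 0%N <> 0.
Proof.
move=> hb b0.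
suff : 1%Z = 0%Z by [].
apply: (hb (fun k => if k is 0%N then 1%Z else 0%Z) _ 0%N) => //.
case: n {hb} => [|n]; first by rewrite /= b0; ring.
rewrite decomp_sum /=; last lia.
by rewrite b0 Rmult_0_r Rplus_0_l; apply: sum_eq_R0 => k _; ring.
Qed.

(* Induction on [n]: a simultaneous Dirichlet approximation gives small increments
   [eta k], and the induction hypothesis for the ratios [eta k / eta 0] tells how many
   of them to add up. *)
Lemma kronecker (n : nat) (b : nat -> R) (th : nat -> R) (eps : R) :
  rat_free b n -> 0 < eps ->
  exists (s : Z) (p : nat -> Z), forall k, (0 < k <= n)%N ->
    Rabs (IZR s * (b k / b 0%N) - th k - IZR (p k)) < eps.
Proof.
elim: n b th eps => [|n IH] b th eps hb e0.
  by exists 0%Z, (fun=> 0%Z) => k; lia.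
have b0 := rat_free_neq0 hb.
have [q [p [q0 hp]]] := @dirichlet_simultaneous (fun k => b k.+1 / b 0%N) n.+1 (eps / 2) ltac:(lra).
pose eta k := INR q * (b k.+1 / b 0%N) - IZR (p k).
have heta : rat_free eta n.
  move=> c hc k kn.
  have [z hz] := sum_IZR (fun k => (c k * p k)%Z) n.
  have : (c k * Z.of_nat q)%Z = 0%Z; last by lia.
  (* A relation among the [eta k] becomes one among the [b k]: the coefficients are multiplied by
     [q], and the integer parts are collected in the coefficient of [b 0]. *)
  apply: (hb (fun k => if k is k'.+1 then (c k' * Z.of_nat q)%Z else Z.opp z) _ k.+1) => //.
  rewrite decomp_sum /=; last lia.
  rewrite opp_IZR -hz.
  have -> : sum_f_R0 (fun k => IZR (c k * Z.of_nat q) * b k.+1) n =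
      b 0%N * sum_f_R0 (fun k => IZR (c k) * eta k) n
      + b 0%N * sum_f_R0 (fun k => IZR (c k * p k)) n.
    rewrite !scal_sum -sum_plus; apply: PartSum.sum_eq => i _.
    by rewrite !mult_IZR -INR_IZR_INZ /eta; field.
  rewrite hc; ring.
have eta0 := rat_free_neq0 heta.
(* The corrected targets make [(th 1 + s) * (eta k / eta 0)] close to [th k.+1] modulo 1. Rounding
   [(th 1 + s) / eta 0] to an integer [j] then costs at most [Rabs (eta k)] in each coordinate. *)
have [s [r hr]] := IH eta (fun k => th k.+1 - th 1%N * (eta k / eta 0%N)) (eps / 2) heta ltac:(lra).
have [j hj] : exists j : Z, Rabs (IZR j * eta 0%N - (th 1%N + IZR s)) <= Rabs (eta 0%N).
  have [h1 h2] := archimed ((th 1%N + IZR s) / eta 0%N).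
  exists (up ((th 1%N + IZR s) / eta 0%N)); move: (up _) h1 h2 => j h1 h2.
  have -> : IZR j * eta 0%N - (th 1%N + IZR s)
     = (IZR j - (th 1%N + IZR s) / eta 0%N) * eta 0%N by field.
  rewrite Rabs_mult; have := Rabs_pos (eta 0%N).
  rewrite (Rabs_pos_eq (IZR j - _)); last lra.
  nra.
exists (j * Z.of_nat q)%Z, (fun k => if k is k'.+1 then
   (j * p k' + (if k' is 0%N then s else r k'))%Z else 0%Z).
case=> [|k] hk; first lia.
have -> (z : Z) : IZR (j * Z.of_nat q) * (b k.+1 / b 0%N) - th k.+1 - IZR (j * p k + z)
   = IZR j * eta k - th k.+1 - IZR z.
  by rewrite /eta plus_IZR !mult_IZR -INR_IZR_INZ; ring.
have ek : Rabs (eta k) < eps / 2 by apply: hp; lia.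
case: k hk ek => [|k] hk ek.
  by rewrite [X in Rabs X](_ : _ = IZR j * eta 0%N - (th 1%N + IZR s)); [lra | ring].
have {}hr := hr k.+1 ltac:(lia).
have {}hj : Rabs ((IZR j * eta 0%N - (th 1%N + IZR s)) * (eta k.+1 / eta 0%N)) <= Rabs (eta k.+1).
  rewrite Rabs_mult /Rdiv Rabs_mult Rabs_inv.
  have e00 := Rabs_pos_lt _ eta0; have z0 := Rabs_pos (eta k.+1).
  move: (Rabs (eta k.+1)) (Rabs (eta 0%N)) (Rabs (_ - _)) z0 e00 hj => z e y z0 e00 hj.
  have -> : z = e * (z * / e) by field; lra.
  have -> : e * (z * / e) * / e = z * / e by field; lra.
  by apply: Rmult_le_compat_r => //; apply: Rle_mult_inv_pos.
rewrite [X in Rabs X](_ : _ = (IZR j * eta 0%N - (th 1%N + IZR s)) * (eta k.+1 / eta 0%N)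
  + (IZR s * (eta k.+1 / eta 0%N) - (th k.+2 - th 1%N * (eta k.+1 / eta 0%N)) - IZR (r k.+1))).
  apply: Rle_lt_trans (Rabs_triang _ _) _; lra.
by field.
Qed.

(** * Translation flows on the circle *)

Lemma sigma_ext {X : Type} (S : (X -> Prop) -> Prop) (A B : X -> Prop) :
  (forall x, A x <-> B x) -> S A -> S B.
Proof. by move=> e; have -> : A = B by apply/funext => x; exact/propext. Qed.

(** * Closure properties of sigma-algebras *)

Section SigmaAlgebra.
Context {X : Type} {S : (X -> Prop) -> Prop} (hS : is_sigma_algebra S).

Lemma sigma_True : S (fun _ => True). Proof. by case: hS. Qed.

Lemma sigma_not A : S A -> S (fun x => ~ A x). Proof. by case: hS => _ [+ _]; apply. Qed.

Lemma sigma_exists (A : nat -> X -> Prop) :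
  (forall n, S (A n)) -> S (fun x => exists n, A n x).
Proof. by case: hS => _ [_]; apply. Qed.

Lemma sigma_const (P : Prop) : S (fun _ => P).
Proof.
have [p|np] := pselect P; first by apply: sigma_ext sigma_True.
by apply: sigma_ext (sigma_not sigma_True) => x; tauto.
Qed.

Lemma sigma_or A B : S A -> S B -> S (fun x => A x \/ B x).
Proof.
move=> hA hB.
apply: (@sigma_ext _ _ (fun x => exists n, (if n is 0%N then A else B) x)).
  move=> x; split=> [[[|n] h]|[h|h]]; [by left|by right|by exists 0%N|by exists 1%N].
by apply: sigma_exists => -[].
Qed.

Lemma sigma_and A B : S A -> S B -> S (fun x => A x /\ B x).
Proof.
move=> hA hB; have := sigma_not (sigma_or (sigma_not hA) (sigma_not hB)).
by apply: sigma_ext => x; split=> [h|]; [split; apply: contrapT|]; tauto.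
Qed.

Lemma sigma_forall (A : nat -> X -> Prop) :
  (forall n, S (A n)) -> S (fun x => forall n, A n x).
Proof.
move=> hA; have := sigma_not (sigma_exists (fun n => sigma_not (hA n))).
apply: sigma_ext => x; split=> [h n|h [n]]; last exact.
by apply: contrapT => nA; apply: h; exists n.
Qed.
End SigmaAlgebra.

Lemma generated_sigma {X : Type} (G : (X -> Prop) -> Prop) : is_sigma_algebra (generated G).
Proof.
split; [|split].
- by move=> S hS _; exact: sigma_True.
- by move=> A hA S hS GS; apply: sigma_not => //; exact: hA.
- by move=> A hA S hS GS; apply: sigma_exists => // n; exact: hA.
Qed.

Lemma generated_incl {X : Type} (G : (X -> Prop) -> Prop) A : G A -> generated G A.
Proof. by move=> GA S _; apply. Qed.

(** The sets with measurable preimage form a sigma-algebra, so generators suffice. *)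
Lemma measurable_generated {Y Z : Type} (SY : (Y -> Prop) -> Prop) (G : (Z -> Prop) -> Prop)
  (g : Y -> Z) : is_sigma_algebra SY -> (forall B, G B -> SY (fun y => B (g y))) ->
  Defs.measurable_fun SY (generated G) g.
Proof.
move=> hY hG B /(_ (fun B => SY (fun y => B (g y)))); apply => //; split; [|split].
- exact: sigma_True.
- by move=> A; exact: sigma_not.
- by move=> A; exact: sigma_exists.
Qed.

(* The circle is modelled by 1-periodic subsets of the line. *)
Definition circle_open (G : R -> Prop) : Prop :=
  (forall x, G x -> exists e, 0 < e /\ forall y, Rabs (y - x) < e -> G y) /\
  (forall x, G (x + 1) <-> G x).

Definition circle_sigma : (R -> Prop) -> Prop := generated circle_open.

Lemma circle_sigmaP : is_sigma_algebra circle_sigma.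
Proof. exact: generated_sigma. Qed.

(** Translation invariance of [circle_mu] is stated for periodic sets; periodicity passes from the
    generators to all generated sets. *)
Lemma circle_sigma_periodic A : circle_sigma A -> forall x, A (x + 1) <-> A x.
Proof.
move/(_ (fun A => forall x, A (x + 1) <-> A x)); apply; last by move=> B [].
split; [|split] => // [B hB x|B hB x]; first by rewrite hB.
by split=> -[n]; exists n; apply/hB.
Qed.

Lemma circle_sigma_borel A : circle_sigma A -> borel_set A.
Proof.
move/(_ borel_set); apply.
  split; [|split].
  - exact: measurableT.
  - by move=> B mB; exact: measurableC.
  - move=> B mB; rewrite [X in borel_set X](_ : _ = (\bigcup_n B n)%classic).
      exact: bigcupT_measurable.
    by apply/funext => x; apply/propext; split=> -[n]; [move=> h|move=> _ h]; exists n.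
move=> B [oB _]; apply: open_measurable.
rewrite openE => x /oB [e [/RltP e0 he]]; apply/nbhs_ballP; exists e => // y /= hy.
by apply: he; apply/RltP; rewrite RabsE distrC.
Qed.

Lemma circle_probability : is_probability_space circle_sigma circle_mu.
Proof.
split; first exact: circle_sigmaP.
split; first by move=> A _; apply/RleP; exact: circle_mu_ge0.
split; first exact: circle_muT.
move=> A hA dA eps /RltP e0.
have [N hN] := circle_mu_sigma (fun n => circle_sigma_borel (hA n)) dA e0.
exists N => n hn; have /RltP := hN n.+1 ltac:(lia).
rewrite -RabsE sum_f_R0E /Rdist Rabs_minus_sym.
congr (Rabs (_ - _) < _); congr circle_mu.
by apply/funext => x; apply/propext; split=> -[n' h]; [move=> h'; exists n'|exists n'].
Qed.

(** Rationals are written with natural parameters so that the unions over them in [circle_flow] are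
    indexed by [nat]. *)
Lemma rational_approx (t eps : R) : 0 < eps ->
  exists a b c : nat, Rabs (t - (INR a - INR b) / INR c.+1) < eps.
Proof.
move=> e0; have [c [_ hc]] := small_inv e0.
have c0 : 0 < INR c.+1 by apply: lt_0_INR; lia.
have [h1 h2] := archimed (t * INR c.+1).
move: (up _) h1 h2 => z h1 h2.
exists (Z.to_nat z), (Z.to_nat (Z.opp z)), c.
have -> : INR (Z.to_nat z) - INR (Z.to_nat (Z.opp z)) = IZR z.
  by rewrite !INR_IZR_INZ -minus_IZR; congr IZR; lia.
have ci : INR c.+1 * / INR c.+1 = 1 by apply: Rinv_r; lra.
have ci0 : 0 < / INR c.+1 by apply: Rinv_0_lt_compat.
have -> : t - IZR z / INR c.+1 = (t * INR c.+1 - IZR z) * / INR c.+1 by field; lra.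
rewrite Rabs_mult (Rabs_pos_eq (/ _)); last lra.
have : Rabs (t * INR c.+1 - IZR z) <= 1 by apply: Rabs_le; lra.
have := Rabs_pos (t * INR c.+1 - IZR z); nra.
Qed.

Lemma circle_shift_measurable s :
  Defs.measurable_fun circle_sigma circle_sigma (fun x => x + s).
Proof.
apply: measurable_generated; first exact: circle_sigmaP.
move=> B [oB pB]; apply: generated_incl; split=> [x /oB [e [e0 he]]|x].
  exists e; split => // y hy; apply: he.
  by have -> : y + s - (x + s) = y - x by ring.
by rewrite -(pB (x + s)) [x + 1 + s](_ : _ = x + s + 1) //; ring.
Qed.

(** The points at distance greater than [r] from the complement of [G]; the margin [eta] keeps this
    set open. *)
Definition thick_core (G : R -> Prop) (r : R) (x : R) : Prop :=
  exists eta, 0 < eta /\ forall y, Rabs (y - x) < r + eta -> G y.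

Lemma thick_core_open G r s : circle_open G -> circle_open (fun x => thick_core G r (x + s)).
Proof.
move=> [_ pG]; split=> [x [eta [e0 he]]|x].
  exists (eta / 2); split=> [|z hz]; first lra.
  exists (eta / 2); split=> [|y hy]; first lra.
  apply: he; have -> : y - (x + s) = (y - (z + s)) + (z - x) by ring.
  by apply: Rle_lt_trans (Rabs_triang _ _) _; lra.
split=> -[eta [e0 he]]; exists eta; split => // y hy.
  by apply/pG; apply: he; have -> : y + 1 - (x + 1 + s) = y - (x + s) by ring.
have -> : y = (y - 1) + 1 by ring.
by apply/pG; apply: he; have -> : y - 1 - (x + s) = y - (x + 1 + s) by ring.
Qed.

Lemma circle_flow lam : is_mp_flow circle_sigma circle_mu (fun t x => x + t * lam).
Proof.
split; first by move=> x; ring.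
split; first by move=> s t x; ring.
split; last first.
  split=> [t|t A hA]; first exact: circle_shift_measurable.
  by apply: circle_mu_shift; [exact: circle_sigma_borel | exact: circle_sigma_periodic].
have hP : is_sigma_algebra (prod_sigma borel circle_sigma) by exact: generated_sigma.
apply: measurable_generated => // G hG.
pose q (a b c : nat) := (INR a - INR b) / INR c.+1.
pose r (d : nat) := / INR d.+1.
(* The preimage of [G] is a countable union of open rectangles. *)
apply (@sigma_ext _ (prod_sigma borel circle_sigma) (fun p : R * R => exists a b c d,
   Rabs (p.1 - q a b c) < r d /\
   thick_core G (r d * Rabs lam) (p.2 + q a b c * lam))).
  move=> [t x] /=; split.
    move=> [a [b [c [d [h [eta [e0 he]]]]]]]; apply: he.
    rewrite [X in Rabs X](_ : _ = (t - q a b c) * lam); last by ring.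
    rewrite Rabs_mult; have := Rabs_pos lam; have := Rabs_pos (t - q a b c); nra.
  move=> Gx; have [e [e0 he]] := proj1 hG _ Gx.
  have lam0 := Rabs_pos lam.
  (* With [r d] this small, the thickness of the core, the replacement of [t] by a rational and the
     margin cost at most e / 3 each. *)
  have [d [rd0 hd]] : exists N : nat, 0 < / INR N.+1 < e / (3 * (Rabs lam + 1)).
    by apply: small_inv; apply: Rdiv_lt_0_compat; lra.
  rewrite -/(r d) in rd0 hd.
  have {}hd : r d * (3 * (Rabs lam + 1)) < e.
    have -> : e = e / (3 * (Rabs lam + 1)) * (3 * (Rabs lam + 1)) by field; lra.
    by apply: Rmult_lt_compat_r => //; lra.
  have [a [b [c habc]]] := rational_approx t rd0.
  exists a, b, c, d; split => //; exists (e / 3); split=> [|y hy]; first lra.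
  apply: he.
  have -> : y - (x + t * lam) = (y - (x + q a b c * lam)) + - ((t - q a b c) * lam) by ring.
  apply: Rle_lt_trans (Rabs_triang _ _) _.
  rewrite Rabs_Ropp Rabs_mult; rewrite -/(q a b c) in habc.
  have := Rabs_pos (t - q a b c); nra.
do 3 (apply: sigma_exists => // ?); apply: sigma_exists => // d.
move: (q _ _ _) => {}q.
apply: generated_incl.
exists (fun t => Rabs (t - q) < r d), (fun x => thick_core G (r d * Rabs lam) (x + q * lam)).
split; [|split => //]; apply: generated_incl; last exact: thick_core_open.
exists (q - r d), (q + r d) => t.
by split=> [/Rabs_def2|] h; [lra | apply: Rabs_def1; lra].
Qed.

(** * Elementary probability *)

Lemma infinite_sum_eventually (g : nat -> R) (s c : R) (N : nat) :
  infinite_sum g s -> (forall n, (N <= n)%N -> sum_f_R0 g n = c) -> s = c.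
Proof.
move=> hs hc; apply: (UL_sequence (sum_f_R0 g)) => // e e0.
by exists N => n hn; rewrite hc ?R_dist_eq //; lia.
Qed.

Section ProbabilitySpace.
Context {X : Type} {S : (X -> Prop) -> Prop} {mu : (X -> Prop) -> R}.
Hypothesis hmu : is_probability_space S mu.

Let hS : is_sigma_algebra S := proj1 hmu.

Lemma mu_ext A B : (forall x, A x <-> B x) -> mu A = mu B.
Proof. by move=> e; congr mu; apply/funext => x; exact/propext. Qed.

Lemma mu_ge0 A : S A -> 0 <= mu A.
Proof. by case: hmu => _ [+ _]; apply. Qed.

Lemma muT : mu (fun _ => True) = 1.
Proof. by case: hmu => _ [_ []]. Qed.

(** Additivity for a sequence of empty sets makes the partial sums converge, so their constant
    increment is 0. *)
Lemma mu_False : mu (fun _ => False) = 0.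
Proof.
have [_ [_ [_ /(_ (fun _ _ => False))]]] := hmu.
move=> /(_ (fun _ => sigma_const hS False)) /(_ ltac:(by [])).
rewrite (@mu_ext (fun x => exists _ : nat, False) (fun _ => False)); last first.
  by move=> x; split => // -[].
move: (mu _) => c hc; apply: cond_eq => e e0.
have [N hN] := hc (e / 2) ltac:(lra).
have := hN N (le_n N); have := hN N.+1 ltac:(lia).
rewrite /Rdist /=; move: (sum_f_R0 _ _) => s h1 h2.
have -> : c - 0 = (s + c - c) - (s - c) by ring.
apply: Rle_lt_trans (Rabs_triang _ _) _; rewrite Rabs_Ropp; lra.
Qed.

Lemma mu_disjoint A B : S A -> S B -> (forall x, A x -> B x -> False) ->
  mu (fun x => A x \/ B x) = mu A + mu B.
Proof.
move=> hA hB dAB.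
have [_ [_ [_ hadd]]] := hmu.
pose F (n : nat) := if n is n'.+1 then if n' is 0%N then B else fun _ => False else A.
have hF n : S (F n) by case: n => [|[|n]] //; exact: sigma_const.
have dF n m x : n <> m -> F n x -> F m x -> False.
  by case: n m => [|[|n]] [|[|m]] //= _ h1 h2 //; [apply: dAB h1 h2 | apply: dAB h2 h1].
have := hadd F hF dF.
rewrite (@mu_ext (fun x => exists n, F n x) (fun x => A x \/ B x)); last first.
  move=> x; split=> [[[|[|n]] h]|[h|h]] //; [by left|by right|by exists 0%N|by exists 1%N].
move/(@infinite_sum_eventually _ _ (mu A + mu B) 1); apply.
elim=> [|[|n] IH] // _.
by rewrite [LHS]/= mu_False Rplus_0_r; apply: IH.
Qed.

Lemma mu_split A B : S A -> S B -> mu A = mu (fun x => A x /\ B x) + mu (fun x => A x /\ ~ B x).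
Proof.
move=> hA hB; rewrite -mu_disjoint; first last.
- by move=> x [_ Bx] [].
- by apply: sigma_and => //; exact: sigma_not.
- exact: sigma_and.
by apply: mu_ext => x; have := pselect (B x); tauto.
Qed.

Lemma mu_mono A B : S A -> S B -> (forall x, A x -> B x) -> mu A <= mu B.
Proof.
move=> hA hB AB; rewrite (mu_split hB hA) (@mu_ext (fun x => B x /\ A x) A).
  by have := mu_ge0 (sigma_and hS hB (sigma_not hS hA)); lra.
by move=> x; have := AB x; tauto.
Qed.

Lemma mu_le1 A : S A -> mu A <= 1.
Proof. by move=> hA; rewrite -muT; apply: mu_mono => //; exact: sigma_True. Qed.

Lemma mu_or_le A B : S A -> S B -> mu (fun x => A x \/ B x) <= mu A + mu B.
Proof.
move=> hA hB; have hBA : S (fun x => B x /\ ~ A x) by apply: sigma_and => //; exact: sigma_not.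
rewrite (@mu_ext (fun x => A x \/ B x) (fun x => A x \/ (B x /\ ~ A x))); last first.
  by move=> x; have := pselect (A x); tauto.
rewrite mu_disjoint //; last by move=> x h [].
by have := @mu_mono _ _ hBA hB ltac:(by move=> x []); lra.
Qed.

(** Continuity from below: the increments [D n] are disjoint with the same union, and their measures
    telescope to [mu (B n)]. *)
Lemma mu_increasing (B : nat -> X -> Prop) : (forall n, S (B n)) ->
  (forall n x, B n x -> B n.+1 x) -> Un_cv (fun n => mu (B n)) (mu (fun x => exists n, B n x)).
Proof.
move=> hB incB.
have le_B n m x : (n <= m)%N -> B n x -> B m x.
  by elim: m => [|m IH]; [case: n|rewrite leq_eqVlt => /orP[/eqP -> //|/IH h /h /incB]].
pose D n := if n is m.+1 then (fun x => B m.+1 x /\ ~ B m x) else B 0%N.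
have hD n : S (D n) by case: n => [|n]; [exact: hB | exact: sigma_and (hB n.+1) (sigma_not hS (hB n))].
have DB n x : D n x -> B n x by case: n => [|n] // [].
have dD n m x : n <> m -> D n x -> D m x -> False.
  wlog nm : n m / (n < m)%N => [hw nm|_].
    have [h|h|//] := ltngtP n m; first exact: (hw n m h nm).
    by move=> h1 h2; exact: (hw m n h (not_eq_sym nm) h2 h1).
  case: m nm => // m nm /DB Bn [_]; apply; exact: le_B Bn.
have [_ [_ [_ /(_ D hD dD)]]] := hmu.
rewrite (@mu_ext (fun x => exists n, D n x) (fun x => exists n, B n x)); last first.
  move=> x; split=> [[n /DB h]|[n]]; first by exists n.
  elim: n => [|n IH] h; first by exists 0%N.
  by have [/IH //|nB] := pselect (B n x); exists n.+1.
have -> // : (fun n => mu (B n)) = sum_f_R0 (fun n => mu (D n)).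
apply/funext; elim=> [//|n IH]; rewrite /= -IH (mu_split (hB n.+1) (hB n)); congr (_ + _).
by apply: mu_ext => x; have := incB n x; tauto.
Qed.

(** The partial unions [B n] increase to the whole union, and finite subadditivity bounds each of
    them by [c]. *)
Lemma mu_union_le (E : nat -> X -> Prop) (c : R) : (forall n, S (E n)) ->
  (forall n, sum_f_R0 (fun i => mu (E i)) n <= c) -> mu (fun x => exists n, E n x) <= c.
Proof.
move=> hE hc.
pose B n x := exists i, (i <= n)%N /\ E i x.
have BS n : S (B n.+1) /\ mu (B n.+1) <= mu (B n) + mu (E n.+1) /\ S (B n).
  have e k x : B k x \/ E k.+1 x <-> B k.+1 x.
    split=> [[[i [ik h]]|h]|[i []]]; first by exists i; split => //; lia.
      by exists k.+1.
    by rewrite leq_eqVlt => /orP[/eqP ->|ik h]; [right|left; exists i].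
  have SB k : S (B k).
    elim: k => [|k IH].
      by apply: sigma_ext (hE 0%N) => x; split=> [h|[[|i] []]] //; exists 0%N.
    by apply: sigma_ext (e k) _; exact: sigma_or.
  by split => //; split => //; rewrite -(mu_ext (e n)); exact: mu_or_le.
have hB n : mu (B n) <= sum_f_R0 (fun i => mu (E i)) n.
  elim: n => [|n IH] /=; last by have := proj1 (proj2 (BS n)); lra.
  by right; apply: mu_ext => x; split=> [[[|i] []]|h] //; exists 0%N.
have := @mu_increasing B (fun n => proj2 (proj2 (BS n))).
move=> /(_ ltac:(by move=> n x [i [h1 h2]]; exists i; split => //; lia)).
rewrite (@mu_ext (fun x => exists n, B n x) (fun x => exists n, E n x)); last first.
  by move=> x; split=> [[n [i [_ h]]]|[n h]]; [exists i | exists n; exists n].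
move=> cv; apply: Rnot_lt_le => hlt.
have [N /(_ N (le_n N))] := cv (mu (fun x => exists n, E n x) - c) ltac:(lra).
by rewrite /Rdist => /Rabs_def2 [_]; have := hB N; have := hc N; lra.
Qed.

Definition ind (A : X -> Prop) (x : X) : R := if pselect (A x) then 1 else 0.

(* Markov's inequality for a counting function, by splitting [B] along each [A k] in turn. *)
Lemma mu_count_le (A : nat -> X -> Prop) (n : nat) (q : R) (B : X -> Prop) :
  (forall k, S (A k)) -> S B -> (forall x, B x -> q <= sum_f_R0 (fun k => ind (A k) x) n) ->
  q * mu B <= sum_f_R0 (fun k => mu (fun x => B x /\ A k x)) n.
Proof.
move=> hA; elim: n q B => [|n IH] q B hB hq.
  have hBA := sigma_and hS hB (hA 0%N).
  have hBN := sigma_and hS hB (sigma_not hS (hA 0%N)).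
  rewrite (mu_split hB (hA 0%N)) /=.
  have h1 := mu_ge0 hBA; have h2 := mu_ge0 hBN.
  (* Each piece either contains a point, where the hypothesis bounds [q], or has measure 0. *)
  have e1 : q <= 1 \/ mu (fun x => B x /\ A 0%N x) = 0.
    have [[x [Bx Ax]]|no] := pselect (exists x, B x /\ A 0%N x).
      by left; have := hq x Bx; rewrite /= /ind; case: pselect => //= ? ?; lra.
    by right; rewrite -mu_False; apply: mu_ext => x; split => // h; apply: no; exists x.
  have e2 : q <= 0 \/ mu (fun x => B x /\ ~ A 0%N x) = 0.
    have [[x [Bx Ax]]|no] := pselect (exists x, B x /\ ~ A 0%N x).
      by left; have := hq x Bx; rewrite /= /ind; case: pselect => //= ? ?; lra.
    by right; rewrite -mu_False; apply: mu_ext => x; split => // h; apply: no; exists x.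
  by case: e1 e2 => [e1|->] [e2|->]; nra.
have hBA := sigma_and hS hB (hA n.+1).
have hBN := sigma_and hS hB (sigma_not hS (hA n.+1)).
(* On [A n.+1] the last set already contributes 1, so the others need only supply q - 1. *)
have h1 : (q - 1) * mu (fun x => B x /\ A n.+1 x)
    <= sum_f_R0 (fun k => mu (fun x => (B x /\ A n.+1 x) /\ A k x)) n.
  apply: IH => // x [Bx Ax]; have := hq x Bx; rewrite /= {2}/ind.
  by case: pselect => //= ? ?; lra.
have h2 : q * mu (fun x => B x /\ ~ A n.+1 x)
    <= sum_f_R0 (fun k => mu (fun x => (B x /\ ~ A n.+1 x) /\ A k x)) n.
  apply: IH => // x [Bx Ax]; have := hq x Bx; rewrite /= {2}/ind.
  by case: pselect => //= ? ?; lra.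
rewrite /= (mu_split hB (hA n.+1)).
have -> : sum_f_R0 (fun k => mu (fun x => B x /\ A k x)) n =
  sum_f_R0 (fun k => mu (fun x => (B x /\ A n.+1 x) /\ A k x)) n +
  sum_f_R0 (fun k => mu (fun x => (B x /\ ~ A n.+1 x) /\ A k x)) n; last lra.
rewrite -sum_plus; apply: PartSum.sum_eq => i _.
rewrite (mu_split (sigma_and hS hB (hA i)) (hA n.+1)).
by congr (_ + _); apply: mu_ext => x; tauto.
Qed.

Lemma mu_disjoint_family (A : nat -> X -> Prop) (c : R) (L : nat) :
  (forall k, S (A k)) -> (forall k, mu (A k) = c) ->
  (forall i j x, (i < j < L)%N -> A i x -> A j x -> False) -> INR L * c <= 1.
Proof.
move=> hA hc dA.
suff [SB <-] : S (fun x => exists i, (i < L)%N /\ A i x) /\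
     mu (fun x => exists i, (i < L)%N /\ A i x) = INR L * c by exact: mu_le1.
elim: L dA => [|L IH] dA.
  rewrite (_ : (fun x => _) = fun _ => False); last first.
    by apply/funext => x; apply/propext; split => // -[i []].
  by rewrite mu_False /=; split; [exact: sigma_const | ring].
have [SB hB] := IH ltac:(by move=> i j x h; apply: dA; lia).
rewrite (_ : (fun x => _) = fun x => (exists i, (i < L)%N /\ A i x) \/ A L x); last first.
  apply/funext => x; apply/propext; split=> [[i []]|[[i [iL h]]|h]].
  - by rewrite ltnS leq_eqVlt => /orP[/eqP ->|iL h]; [right|left; exists i].
  - by exists i; split => //; lia.
  - by exists L.
split; first exact: sigma_or.
rewrite mu_disjoint //; first by rewrite hB hc S_INR; ring.
by move=> x [i [iL h]]; apply: dA h; lia.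
Qed.
End ProbabilitySpace.

(** * Rationally independent sequences are not pointwise good *)

(** Modulo 1, [m x] lies in an arc of length 1 / L. The asymmetric window (-1, 2) is the sum of the
    phase error (-1, 1) and the rounding error [0, 1) that occur in [sweep]. *)
Definition near_int (m : Z) (L : nat) (x : R) : Prop :=
  exists p : Z, - 1 < 3 * INR L * (IZR m * x - IZR p) < 2.

Lemma near_int_open m L : circle_open (near_int m L).
Proof.
split=> [x [p hp]|x]; last first.
  split=> -[p hp].
    exists (Z.sub p m); rewrite minus_IZR.
    by have -> : IZR m * x - (IZR p - IZR m) = IZR m * (x + 1) - IZR p by ring.
  exists (Z.add p m); rewrite plus_IZR.
  by have -> : IZR m * (x + 1) - (IZR p + IZR m) = IZR m * x - IZR p by ring.
move: hp; set c := 3 * INR L * (IZR m * x - IZR p) => hp.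
pose K := Rabs (3 * INR L * IZR m) + 1.
have K0 : 0 < K by have := Rabs_pos (3 * INR L * IZR m); rewrite /K; lra.
pose eta := Rmin (c + 1) (2 - c).
have [e1 e2] : eta <= c + 1 /\ eta <= 2 - c by split; [exact: Rmin_l|exact: Rmin_r].
have e0 : 0 < eta by apply: Rmin_glb_lt; lra.
exists (eta / K); split=> [|y hy]; first exact: Rdiv_lt_0_compat.
exists p; have -> : 3 * INR L * (IZR m * y - IZR p) = c + 3 * INR L * IZR m * (y - x).
  by rewrite /c; ring.
have : Rabs (3 * INR L * IZR m * (y - x)) < eta.
  rewrite Rabs_mult; have -> : eta = K * (eta / K) by field; lra.
  apply: Rle_lt_trans (Rmult_lt_compat_l _ _ _ K0 hy).
  by apply: Rmult_le_compat_r; [exact: Rabs_pos | rewrite /K; lra].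
by move/Rabs_def2; lra.
Qed.

Lemma near_int_sigma m L : circle_sigma (near_int m L).
Proof. exact: generated_incl (near_int_open m L). Qed.

(* The [L] translates by multiples of [1 / (m L)] are pairwise disjoint. *)
Lemma near_int_mu (m : Z) (L : nat) : m <> Z0 -> (0 < L)%N ->
  circle_mu (near_int m L) <= / INR L.
Proof.
move=> m0 L0.
have m0' : IZR m <> 0 := not_0_IZR m m0.
have L0' : 0 < INR L by apply: lt_0_INR; lia.
suff : INR L * circle_mu (near_int m L) <= 1.
  move=> h; apply: (Rmult_le_reg_l (INR L)) => //; rewrite Rinv_r //; lra.
apply: (@mu_disjoint_family _ _ _ circle_probability
   (fun j x => near_int m L (x + INR j / (IZR m * INR L)))).
- by move=> j; apply: circle_shift_measurable; exact: near_int_sigma.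
- move=> j; apply: circle_mu_shift; first exact: circle_sigma_borel (near_int_sigma m L).
  exact: circle_sigma_periodic (near_int_sigma m L).
move=> i j x ij [p hp] [q hq].
(* Membership in the k-th translate places [L m x] plus an integer congruent to k modulo L in a
   window of length 1. Two such integers coincide, so i and j would be congruent modulo L. *)
have e k r : 3 * INR L * (IZR m * (x + INR k / (IZR m * INR L)) - IZR r)
   = 3 * (INR L * (IZR m * x) + IZR (Z.of_nat k - Z.of_nat L * r)).
  rewrite minus_IZR mult_IZR -!INR_IZR_INZ; field; lra.
rewrite !e in hp hq.
have h1 : (Z.of_nat j - Z.of_nat L * q < Z.of_nat i - Z.of_nat L * p + 1)%Z.
  by apply: lt_IZR; rewrite plus_IZR; lra.
have h2 : (Z.of_nat i - Z.of_nat L * p < Z.of_nat j - Z.of_nat L * q + 1)%Z.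
  by apply: lt_IZR; rewrite plus_IZR; lra.
have h3 : (Z.of_nat j - Z.of_nat i = Z.of_nat L * (q - p))%Z by nia.
have : (0 < q - p < 1)%Z by nia.
lia.
Qed.

(* Kronecker's theorem lets the phase advance by one step on each block
   [(B ^ (e - 1), B ^ e]], so some block carries [x] into the set. *)
Lemma sweep (b : nat -> R) (L B : nat) : (forall n, rat_free b n) -> (0 < L)%N -> (1 < B)%N ->
  exists m : Z, m <> Z0 /\ forall x, exists e : nat, forall k : nat,
    (B ^ e < k <= B ^ e.+1)%N -> near_int m L (x + b k / b 0%N).
Proof.
move=> hb L0 B1.
have L0' : 0 < INR L by apply: lt_0_INR; lia.
(* [up_log B k] equals e + 1 exactly on the block (B ^ e, B ^ (e + 1)]. The exponent 3 L + 1 covers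
   the blocks e = 1, ..., 3 L, one for each phase. *)
have [m [p hp]] := @kronecker (B ^ (3 * L + 1))%N b
   (fun k => INR (up_log B k) / (3 * INR L)) (/ (3 * INR L)) (hb _) ltac:(apply: Rinv_0_lt_compat; lra).
have {}hp k : (0 < k <= B ^ (3 * L + 1))%N ->
    -1 < 3 * INR L * (IZR m * (b k / b 0%N) - IZR (p k)) - INR (up_log B k) < 1.
  move/hp; move: (IZR m * _) => z hz.
  have -> : 3 * INR L * (z - IZR (p k)) - INR (up_log B k) =
      (3 * INR L) * (z - INR (up_log B k) / (3 * INR L) - IZR (p k)) by field; lra.
  have e : 3 * INR L * / (3 * INR L) = 1 by apply: Rinv_r; lra.
  by have [h1 h2] := Rabs_def2 _ _ hz; nra.
exists m; split.
  (* If m = 0, the estimate at k = B ^ 2 would force 2 to be a multiple of 3. *)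
  move=> m0; have := hp (B ^ 2)%N.
  have -> : up_log B (B ^ 2) = 2%N by apply: up_expnK.
  have -> : (0 < B ^ 2 <= B ^ (3 * L + 1))%N by rewrite expn_gt0 leq_exp2l //; lia.
  move=> /(_ isT); rewrite m0 Rmult_0_l.
  have -> : 3 * INR L * (0 - IZR (p (B ^ 2)%N)) - INR 2 = IZR (- (3 * (Z.of_nat L * p (B ^ 2)%N)) - 2).
    by rewrite minus_IZR opp_IZR !mult_IZR -INR_IZR_INZ /=; ring.
  by move=> [/lt_IZR h1 /lt_IZR h2]; lia.
move=> x.
have [h1 h2] := archimed (3 * INR L * (IZR m * x)).
move: (up _) h1 h2 => q h1 h2.
pose M := (3 * Z.of_nat L)%Z.
have M0 : (0 < M)%Z by lia.
(* [e] represents -q modulo 3 L in the range 1, ..., 3 L, so that e + 1 + q is 1 modulo 3 L. *)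
pose e := Z.to_nat ((- q - 1) mod M + 1).
have [he1 he2] := Z.mod_pos_bound (- q - 1) M M0.
have he : Z.of_nat e = ((- q - 1) mod M + 1)%Z by lia.
have hdiv := Z.div_mod (- q - 1) M ltac:(lia).
move: ((- q - 1) / M)%Z hdiv => r hdiv.
exists e => k /andP[k1 k2].
have := hp k; have -> : up_log B k = e.+1 by apply: up_log_eq => //; lia.
have -> : (0 < k <= B ^ (3 * L + 1))%N.
  by rewrite (leq_trans _ k1) //= (leq_trans k2) // leq_exp2l //; lia.
move=> /(_ isT) hk.
exists (p k - r)%Z.
have -> : 3 * INR L * (IZR m * (x + b k / b 0%N) - IZR (p k - r)) =
   (3 * INR L * (IZR m * (b k / b 0%N) - IZR (p k)) - INR e.+1)
   + (3 * INR L * (IZR m * x) - IZR q) + (INR e.+1 + IZR q + IZR (M * r)).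
  by rewrite minus_IZR !mult_IZR -INR_IZR_INZ; ring.
have -> : INR e.+1 + IZR q + IZR (M * r) = 1.
  by rewrite INR_IZR_INZ -!plus_IZR; congr IZR; lia.
lra.
Qed.

Lemma ind_ge0 {X : Type} (A : X -> Prop) x : 0 <= ind A x.
Proof. by rewrite /ind; case: pselect => /= _; lra. Qed.

Lemma ind_le1 {X : Type} (A : X -> Prop) x : ind A x <= 1.
Proof. by rewrite /ind; case: pselect => /= _; lra. Qed.

Lemma ind1 {X : Type} (A : X -> Prop) x : A x -> ind A x = 1.
Proof. by rewrite /ind; case: pselect. Qed.

Lemma ind_Linfty {X : Type} S mu (A : X -> Prop) : is_probability_space S mu -> S A ->
  is_Linfty S mu (ind A).
Proof.
move=> hmu hA; have hS := proj1 hmu; split.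
  move=> B _.
  have := sigma_or hS (sigma_and hS hA (sigma_const hS (B 1)))
            (sigma_and hS (sigma_not hS hA) (sigma_const hS (B 0))).
  by apply: sigma_ext => x; rewrite /ind; case: pselect => /= ?; tauto.
exists 1, (fun _ => False); split; first exact: sigma_const.
split=> [|x _]; first exact: (mu_False hmu).
by apply: Rabs_le; have := ind_ge0 A x; have := ind_le1 A x; lra.
Qed.

Lemma sum_ind_measurable {X : Type} S (A : nat -> X -> Prop) n q : is_sigma_algebra S ->
  (forall k, S (A k)) -> S (fun x => q <= sum_f_R0 (fun k => ind (A k) x) n).
Proof.
move=> hS hA.
have split_ind B C k : S B -> S C -> S (fun x => (A k x /\ B x) \/ (~ A k x /\ C x)).
  by move=> hB hC; apply: sigma_or => //; apply: sigma_and => //; exact: sigma_not.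
elim: n q => [|n IH] q.
  have := split_ind _ _ 0%N (sigma_const hS (q <= 1)) (sigma_const hS (q <= 0)).
  by apply: sigma_ext => x /=; rewrite /ind; case: pselect => /= ?; tauto.
have := split_ind _ _ n.+1 (IH (q - 1)) (IH q).
apply: sigma_ext => x /=; rewrite {4}/ind; case: pselect => /= ?.
  split=> [[[_ ?]|[]//]|?]; [lra | left; split => //; lra].
split=> [[[]//|[_ ?]]|?]; [lra | right; split => //; lra].
Qed.

(** Counts visits along an orbit: the terms from [M] to [n] are all visits, and the earlier ones are
    only known to be non-negative. *)
Lemma sum_tail_ge (g : nat -> R) (M n : nat) : (forall j, 0 <= g j) ->
  (forall j, (M <= j <= n)%N -> g j = 1) -> INR n.+1 - INR M <= sum_f_R0 g n.
Proof.
move=> g0; elim: n => [|n IH] g1.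
  case: M g1 => [|M] g1; first by rewrite /= g1 //; lra.
  by have := g0 0%N; have := pos_INR M; rewrite !S_INR /=; lra.
have [h|h] := leqP M n.+1.
  rewrite tech5 g1 ?leqnn ?h //; have := IH ltac:(by move=> j hj; apply: g1; lia).
  by rewrite (S_INR n.+1); lra.
have : INR n.+2 <= INR M by apply: le_INR; lia.
by have := cond_pos_sum g n.+1 g0; lra.
Qed.

Lemma sum_half_pow n : sum_f_R0 (fun i => / INR (2 ^ (i + 3))) n <= / 4.
Proof.
suff : sum_f_R0 (fun i => / INR (2 ^ (i + 3))) n = / 4 - / INR (2 ^ (n + 3)).
  have : 0 < / INR (2 ^ (n + 3)) by apply: Rinv_0_lt_compat; apply: lt_0_INR; lia.
  lra.
elim: n => [|n IH] /=; first by rewrite /expn /=; lra.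
rewrite IH addSn expnS mult_INR Rinv_mult.
have -> : INR 2 = 2 by [].
lra.
Qed.

(* The averages of the indicator of [E] have upper limit 1 at every point,
   whereas by Markov's inequality they are at most 1/2 with probability at least 1/2. *)
Lemma rat_free_not_good (a b : nat -> R) : (forall n, rat_free b n) ->
  (forall k, (0 < k)%N -> b k = a k) -> ~ pointwise_good a.
Proof.
move=> hb hab good.
pose lam := / b 0%N.
(* The i-th set has measure at most 2 ^ -(i + 3), for a total of at most 1/4; the ratio i + 2 makes
   a block the fraction 1 - 1 / (i + 2) of all times up to its end. *)
have [m hm] := choice (fun i : nat => @sweep b (2 ^ (i + 3)) i.+2 hb
  ltac:(by rewrite expn_gt0) isT).
pose E x := exists i, near_int (m i) (2 ^ (i + 3)) x.
have SE : circle_sigma E by apply: (sigma_exists circle_sigmaP) => i; exact: near_int_sigma.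
have muE : circle_mu E <= / 4.
  apply: (mu_union_le circle_probability) => [i|n]; first exact: near_int_sigma.
  apply: Rle_trans (sum_half_pow n); apply: sum_Rle => i _.
  by apply: near_int_mu; [case: (hm i) | rewrite expn_gt0].
pose A k x := E (x + a k.+1 * lam).
have SA k : circle_sigma (A k) by apply: circle_shift_measurable.
have muA k : circle_mu (A k) = circle_mu E.
  apply: circle_mu_shift; [exact: circle_sigma_borel | exact: circle_sigma_periodic].
pose U (t x : R) := x + t * lam.
have [N [SN [muN conv]]] := good _ _ _ U (ind E) circle_probability (circle_flow lam)
   (ind_Linfty circle_probability SE).
pose Sn n x := sum_f_R0 (fun k => ind (A k) x) n.
have avgE x n : avg U (ind E) a x n = Sn n x / INR n.+1 by [].
have large x i : exists n, (i <= n)%N /\ 1 - / INR i.+2 <= avg U (ind E) a x n.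
  have [_ /(_ x) [e he]] := hm i.
  have pos : (0 < i.+2 ^ e)%N by rewrite expn_gt0.
  have n1 : (i.+2 ^ e.+1).-1.+1 = (i.+2 ^ e.+1)%N by rewrite prednK // expn_gt0.
  (* Index n of [avg] averages over the times 1, ..., n + 1, hence the predecessor. *)
  exists (i.+2 ^ e.+1).-1; split; first by move: pos n1; rewrite expnS; nia.
  rewrite avgE n1.
  have pos' : 0 < INR (i.+2 ^ e) by apply: lt_0_INR; lia.
  have i0 : 0 < INR i.+2 by apply: lt_0_INR; lia.
  have := @sum_tail_ge (fun k => ind (A k) x) (i.+2 ^ e) (i.+2 ^ e.+1).-1
    (fun k => ind_ge0 (A k) x).
  rewrite n1 -/(Sn _ _) expnS mult_INR => h.
  apply: (Rmult_le_reg_r (INR i.+2 * INR (i.+2 ^ e))); first exact: Rmult_lt_0_compat.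
  have -> : (1 - / INR i.+2) * (INR i.+2 * INR (i.+2 ^ e)) =
     INR i.+2 * INR (i.+2 ^ e) - INR (i.+2 ^ e) by field; lra.
  rewrite /Rdiv Rmult_assoc Rinv_l ?Rmult_1_r; last by apply: Rgt_not_eq; exact: Rmult_lt_0_compat.
  apply: h => j /andP[j1 j2]; apply: ind1; exists i; rewrite -hab //.
  by apply: he; move: n1; rewrite expnS; move: (_ * _)%N j2 => y j2; lia.
pose Q n x := INR n.+1 / 2 <= Sn n x.
have SQ n : circle_sigma (Q n) by apply: sum_ind_measurable => //; exact: circle_sigmaP.
have muQ n : circle_mu (Q n) <= / 2.
  have n0 : 0 < INR n.+1 by apply: lt_0_INR; lia.
  have := @mu_count_le _ _ _ circle_probability A n (INR n.+1 / 2) (Q n) SA (SQ n) ltac:(by []).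
  have : sum_f_R0 (fun k => circle_mu (fun x => Q n x /\ A k x)) n <= INR n.+1 * / 4.
    rewrite Rmult_comm -sum_cte; apply: sum_Rle => k _.
    apply: Rle_trans muE; rewrite -(muA k); apply: (mu_mono circle_probability) => //.
      exact: (sigma_and circle_sigmaP).
    by move=> x [].
  move=> h1 h2; apply: (Rmult_le_reg_l (INR n.+1)) => //.
  by have := Rle_trans _ _ _ h2 h1; lra.
(* [B n] says that the averages stay at least 1/2 from n on. These sets increase and cover every
   point of convergence, where the limit is at least 1, yet each has measure at most 1/2. *)
pose B n x := forall k, Q (n + k)%N x.
have SB n : circle_sigma (B n) by apply: (sigma_forall circle_sigmaP).
have muB n : circle_mu (B n) <= / 2.
  apply: Rle_trans (muQ n); apply: (mu_mono circle_probability) => // x /(_ 0%N).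
  by rewrite addn0.
have inc n x : B n x -> B n.+1 x by move=> h k; rewrite addSnnS; exact: h.
have := mu_increasing circle_probability SB inc.
have -> : circle_mu (fun x => exists n, B n x) = 1.
  apply: Rle_antisym; first exact: mu_le1 circle_probability _ (sigma_exists circle_sigmaP SB).
  have -> : 1 = circle_mu (fun x => N x \/ ~ N x).
    rewrite -(muT circle_probability); apply: mu_ext => x; have := pselect (N x); tauto.
  apply: Rle_trans (mu_or_le circle_probability SN (sigma_not circle_sigmaP SN)) _.
  rewrite muN Rplus_0_l; apply: (mu_mono circle_probability).
  - exact: (sigma_not circle_sigmaP).
  - exact: (sigma_exists circle_sigmaP).
  move=> x /conv [l hl].
  have l1 : 1 <= l.
    apply: Rnot_lt_le => ll; have [i [i0 hi]] := @small_inv ((1 - l) / 2) ltac:(lra).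
    have [M hM] := hl ((1 - l) / 2) ltac:(lra).
    have [n [hn hn']] := large x (M + i)%N.
    have := hM n ltac:(lia); rewrite /Rdist => /Rabs_def2 [h _].
    have : / INR (M + i).+2 <= / INR i.+1.
      by apply: Rinv_le_contravar; [apply: lt_0_INR | apply: le_INR]; lia.
    lra.
  have [M hM] := hl (/ 2) ltac:(lra).
  exists M => k; have := hM (M + k)%N ltac:(lia); rewrite /Rdist avgE => /Rabs_def2 [_ h].
  have n0 : 0 < INR (M + k).+1 by apply: lt_0_INR; lia.
  rewrite /Q; have -> : Sn (M + k)%N x = INR (M + k).+1 * (Sn (M + k)%N x / INR (M + k).+1).
    by field; lra.
  by apply: Rmult_le_compat_l; lra.
move=> /(_ (/ 4) ltac:(lra)) [n /(_ n (le_n n))]; rewrite /Rdist => /Rabs_def2 [_].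
by have := muB n; lra.
Qed.

(** * Iterated differences *)

Fixpoint iter_diff (n : nat) (h : R) (g : R -> R) (y : R) : R :=
  if n is n'.+1 then iter_diff n' h (fun z => g (z + h) - g z) y else g y.

(* Replacing (s, r) by (s + t, r - j t) leaves the argument of [g j] fixed; the
   difference of the two identities therefore no longer involves [g j]. *)
Lemma iter_diff_eq0 (js : seq nat) (j0 : nat) : j0 \notin js ->
  exists kap, 0 < kap /\ forall (rho : R) (N : nat) (g : nat -> R -> R), 0 < rho -> (j0 <= N)%N ->
    (forall k, (k <= N)%N -> k \notin j0 :: js -> forall y, g k y = 0) ->
    (forall s r, Rabs s < rho -> Rabs r < rho ->
       sum_f_R0 (fun k => g k (INR k * s + r)) N = 0) ->
    forall y h, Rabs y < kap * rho -> Rabs h < kap * rho -> iter_diff (size js) h (g j0) y = 0.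
Proof.
elim: js => [|j1 js IH].
  move=> _; exists 1; split=> [|rho N g rho0 j0N g0 hg y h hy _ /=]; first lra.
  have := hg 0 y ltac:(rewrite Rabs_R0; lra) ltac:(lra).
  have -> : sum_f_R0 (fun k => g k (INR k * 0 + y)) N = g j0 y; last by [].
  have e k : INR k * 0 + y = y by ring.
  elim: N j0N g0 {hg} => [|N IH] j0N g0.
    have -> : j0 = 0%N by lia.
    by change (g 0%N (INR 0 * 0 + y) = g 0%N y); rewrite e.
  rewrite tech5 e; have [j0E|j0N'] := eqVneq j0 N.+1.
    rewrite -j0E sum_eq_R0 ?Rplus_0_l // => k kN.
    by apply: g0; [|rewrite inE; apply/eqP => kj]; lia.
  rewrite IH; [|lia|by move=> k kN; apply: g0; lia].
  by rewrite (g0 N.+1) ?Rplus_0_r // inE eq_sym.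
rewrite inE negb_or => /andP[/eqP j01 /IH [kap [kap0 hkap]]].
have j1p := pos_INR j1.
have i0 : 0 < / (2 * (1 + INR j1)) by apply: Rinv_0_lt_compat; lra.
(* One bound pays for halving [rho]; the other keeps the displacements [t] and [j1 t] below rho /
   2. *)
exists (Rmin (kap / 2) (/ (2 * (1 + INR j1)))); split=> [|rho N g rho0 j0N g0 hg y h].
  by apply: Rmin_glb_lt => //; lra.
set kk := Rmin _ _ => hy hh.
have [k1 k2] : kk <= kap / 2 /\ kk <= / (2 * (1 + INR j1)).
  by split; [exact: Rmin_l | exact: Rmin_r].
have dj : INR j0 - INR j1 <> 0 by move=> e; apply: j01; apply: INR_eq; lra.
have dj1 : 1 <= Rabs (INR j0 - INR j1).
  have [lt|lt|//] := ltngtP j0 j1.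
    have : INR j0.+1 <= INR j1 by apply: le_INR; lia.
    by rewrite S_INR => ?; rewrite Rabs_left1; lra.
  have : INR j1.+1 <= INR j0 by apply: le_INR; lia.
  by rewrite S_INR => ?; rewrite Rabs_pos_eq; lra.
(* Chosen so that the argument of [g j0] moves by exactly [h] while that of [g j1] stays fixed. *)
pose t := h / (INR j0 - INR j1).
have th : Rabs t <= Rabs h.
  have -> : h = t * (INR j0 - INR j1) by rewrite /t; field.
  by rewrite Rabs_mult; have := Rabs_pos t; nra.
have tb : (1 + INR j1) * Rabs t < rho / 2.
  have e : / (2 * (1 + INR j1)) * (1 + INR j1) = / 2 by field; lra.
  have : Rabs t < / (2 * (1 + INR j1)) * rho by nra.
  move/(Rmult_lt_compat_l (1 + INR j1) _ _ ltac:(lra)); rewrite -Rmult_assoc (Rmult_comm (1 + _) (/ _)) e; lra.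
have tp := Rabs_pos t.
pose g' k z := g k (z + (INR k - INR j1) * t) - g k z.
have := hkap (rho / 2) N g' ltac:(lra) j0N.
have -> : g' j0 = fun z => g j0 (z + h) - g j0 z.
  by apply/funext => z; rewrite /g'; do 3 f_equal; rewrite /t; field.
apply; [| |nra|nra].
- move=> k kN; rewrite inE negb_or => /andP[kj0 kjs] z; rewrite /g'.
  have [->|kj1] := eqVneq k j1; first by rewrite Rminus_diag Rmult_0_l Rplus_0_r Rminus_diag.
  have kg : k \notin [:: j0, j1 & js] by rewrite !inE !negb_or kj0 kj1.
  by rewrite !(g0 k kN kg) Rminus_0_r.
move=> s r hs hr.
have e1 := hg (s + t) (r - INR j1 * t).
have e2 := hg s r ltac:(lra) ltac:(lra).
have b1 : Rabs (s + t) < rho by apply: Rle_lt_trans (Rabs_triang _ _) _; nra.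
have b2 : Rabs (r - INR j1 * t) < rho.
  apply: Rle_lt_trans (Rabs_triang _ _) _; rewrite Rabs_Ropp Rabs_mult (Rabs_pos_eq (INR j1)) //; nra.
rewrite -(Rminus_diag 0) -{1}(e1 b1 b2) -e2 -minus_sum; apply: PartSum.sum_eq => k _.
rewrite /g'; congr (g k _ - g k _); ring.
Qed.

Lemma iter_diff_sub n h g g' y :
  iter_diff n h (fun z => g z - g' z) y = iter_diff n h g y - iter_diff n h g' y.
Proof.
elim: n g g' => [//|n IH] g g' /=; rewrite -IH; congr (iter_diff n h _ y).
by apply/funext => z; ring.
Qed.

(** * Differences and interpolation of polynomials *)

Section PolynomialDifference.
Local Open Scope ring_scope.

(** A shift of the variable keeps degree and leading coefficient, so the leading terms cancel. *)
Lemma size_shift_sub (K : idomainType) (p : {poly K}) (h : K) (n : nat) :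
  (size p <= n.+1)%N -> (size (p \Po ('X + h%:P) - p)%R <= n)%N.
Proof.
move=> sp; apply/leq_sizeP => j nj; rewrite coefB.
have sX : size ('X + h%:P) = 2 by rewrite size_XaddC.
have sc : size (p \Po ('X + h%:P)) = size p by rewrite size_comp_poly2.
have [lt|ge] := leqP (size p) j; first by rewrite !nth_default ?sc ?subrr.
have jE : j = (size p).-1 by lia.
apply/eqP; rewrite subr_eq0 jE -{1}sc -!lead_coefE.
by rewrite lead_coef_comp ?sX // lead_coefXaddC expr1n mulr1.
Qed.

(** Newton's scheme: a new node is served by adding a multiple of the product that vanishes at the
    earlier nodes. *)
Lemma interpolation (K : fieldType) (n : nat) (x y : nat -> K) :
  (forall i j, (i < j < n)%N -> x i != x j) ->
  exists p : {poly K}, (size p <= n)%N /\ forall i, (i < n)%N -> p.[x i] = y i.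
Proof.
elim: n => [|n IH] hx; first by exists 0; rewrite size_poly0.
have [|p [sp hp]] := IH; first by move=> i j ij; apply: hx; lia.
pose q := \prod_(i <- map x (iota 0 n)) ('X - i%:P).
have sq : size q = n.+1 by rewrite size_prod_XsubC size_map size_iota.
have q0 i : (i < n)%N -> q.[x i] = 0.
  move=> ilt; apply/eqP; rewrite -/(root _ _) root_prod_XsubC.
  by apply: map_f; rewrite mem_iota.
have qn : q.[x n] != 0.
  rewrite -/(root _ _) root_prod_XsubC; apply/mapP => -[i]; rewrite mem_iota => ilt e.
  by have := hx i n ltac:(lia); rewrite e eqxx.
exists (p + ((y n - p.[x n]) / q.[x n]) *: q); split.
  rewrite (leq_trans (size_polyD _ _)) // geq_max (leq_trans sp) //=.
  by rewrite (leq_trans (size_scale_leq _ _)) // sq.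
move=> i; rewrite ltnS leq_eqVlt hornerD hornerZ => /orP[/eqP ->|ilt].
  by rewrite divfK // addrC subrK.
by rewrite (q0 i ilt) mulr0 addr0 hp.
Qed.

Lemma poly_eq_points (K : idomainType) (n : nat) (x : nat -> K) (p q : {poly K}) :
  (forall i j, (i < j < n)%N -> x i != x j) -> (size p <= n)%N -> (size q <= n)%N ->
  (forall i, (i < n)%N -> p.[x i] = q.[x i]) -> p = q.
Proof.
move=> hx sp sq e; apply/eqP; rewrite -subr_eq0; apply: contraT => nz.
have := @max_poly_roots _ (p - q) (map x (iota 0 n)) nz.
rewrite size_map size_iota => H.
suff : (n < size (p - q)%R)%N.
  by rewrite ltnNge (leq_trans (size_polyD _ _)) // geq_max size_polyN sp.
apply: H.
  apply/allP => _ /mapP[i + ->]; rewrite mem_iota => ilt.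
  by rewrite /root hornerD hornerN e ?subrr //; lia.
rewrite map_inj_in_uniq ?iota_uniq // => i j; rewrite !mem_iota => hi hj eij.
by have [lt|lt|//] := ltngtP i j; have := hx _ _ ltac:(apply/andP; split; [exact: lt|lia]); rewrite eij eqxx.
Qed.
Lemma iter_diff_poly (p : {poly R}) (n : nat) (h y : R) : (size p <= n)%N ->
  iter_diff n h (fun z => p.[z]) y = 0.
Proof.
elim: n p => [|n IH] p sp /=.
  by move: sp; rewrite leqn0 size_poly_eq0 => /eqP ->; rewrite horner0.
rewrite (_ : (fun z => _) = fun z => (p \Po ('X + h%:P) - p).[z]).
  exact/IH/size_shift_sub.
by apply/funext => z; rewrite hornerD hornerN horner_comp hornerD hornerX hornerC.
Qed.
End PolynomialDifference.

(** By induction the first difference vanishes along the grid, so [g] keeps its initial value 0. *)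
Lemma grid_eq0 (n : nat) (h : R) (g : R -> R) (J : nat) :
  (forall j, (j < J)%N -> iter_diff n h g (INR j * h) = 0) ->
  (forall j, (j < n)%N -> g (INR j * h) = 0) ->
  forall j, (j < J + n)%N -> g (INR j * h) = 0.
Proof.
elim: n g => [|n IH] g hd h0; first by move=> j; rewrite addn0 => /hd.
have step j : INR j.+1 * h = INR j * h + h by rewrite S_INR; ring.
have {}IH := IH (fun z => g (z + h) - g z) hd.
have {}IH j : (j < J + n)%N -> g (INR j.+1 * h) = g (INR j * h).
  move=> jlt; apply: Rminus_diag_uniq; rewrite step; apply: IH jlt => i ilt.
  by rewrite -step !h0 //; [ring | lia].
by elim=> [|j IHj] jlt; [exact: h0 | rewrite IH ?IHj //; lia].
Qed.

(** Subtracting the interpolant through the first [n] grid points preserves the vanishing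
    differences and reduces to [grid_eq0]. *)
Lemma grid_poly (n : nat) (h : R) (g : R -> R) (J : nat) : h <> 0 ->
  (forall j, (j < J)%N -> iter_diff n h g (INR j * h) = 0) ->
  exists p : {poly R}, (size p <= n)%N /\
    forall j, (j < J + n)%N -> g (INR j * h) = horner p (INR j * h).
Proof.
move=> h0 hd.
have [|p [sp hp]] := @interpolation R n (fun j => INR j * h) (fun j => g (INR j * h)).
  move=> i j ij; apply/eqP => e; have := Rmult_eq_reg_r _ _ _ e h0.
  by move/INR_eq; lia.
exists p; split => // j jlt; apply: Rminus_diag_uniq.
apply: (@grid_eq0 n h (fun z => g z - horner p z) J) jlt => i ilt.
  by rewrite iter_diff_sub hd // iter_diff_poly // Rminus_0_r.
by rewrite hp // Rminus_diag.
Qed.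

Lemma horner_sum_f_R0 (p : {poly R}) n x : (size p <= n.+1)%N ->
  horner p x = sum_f_R0 (fun i => nth 0 p i * x ^ i) n.
Proof.
move=> sp; rewrite (horner_coef_wide _ sp) sum_f_R0E big_mkord.
by apply: eq_bigr => i _; rewrite RpowE.
Qed.

Lemma continuity_horner (p : {poly R}) x : continuity_pt (horner p) x.
Proof.
rewrite (_ : horner p = fun y => sum_f_R0 (fun i => nth 0 p i * y ^ i) (size p)); last first.
  by apply/funext => y; apply: horner_sum_f_R0.
apply: (continuity_pt_finite_SF (fun i y => nth 0 p i * y ^ i)) => k _.
apply: continuity_pt_mult; first exact: continuity_pt_const.
exact/derivable_continuous_pt/derivable_pt_pow.
Qed.

(* All the grids [d / N] share the points [0, d, ..., (n - 1) d], so the polynomials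
   interpolating [g] on them coincide. *)
Lemma iter_diff_eq0_poly (n : nat) (g : R -> R) (rho : R) : 0 < rho ->
  (forall y h, Rabs y < rho -> Rabs h < rho -> iter_diff n h g y = 0) ->
  (forall y, Rabs y < rho -> continuity_pt g y) ->
  exists (p : {poly R}) (d : R), 0 < d /\ forall x, 0 < x < d -> g x = horner p x.
Proof.
move=> rho0 hd cg.
have n0 : 0 < INR n.+2 by apply: lt_0_INR; lia.
(* Dividing by n + 2 keeps [0, (n + 1) d] within the radius [rho]. *)
pose d := rho / INR n.+2.
have d0 : 0 < d by apply: Rdiv_lt_0_compat.
have dE : d * INR n.+1 < rho.
  have -> : rho = d * INR n.+2 by rewrite /d; field; lra.
  by rewrite (S_INR n.+1); nra.
have n1 : 1 <= INR n.+1 by rewrite S_INR; have := pos_INR n; lra.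
have grid N : exists p : {poly R}, (size p <= n)%N /\
    forall j, (j < N.+1 * n.+1)%N -> g (INR j * (d / INR N.+1)) = horner p (INR j * (d / INR N.+1)).
  have N0 : 0 < INR N.+1 by apply: lt_0_INR; lia.
  have iN : / INR N.+1 <= 1.
    by rewrite -Rinv_1; apply: Rinv_le_contravar; [lra | rewrite S_INR; have := pos_INR N; lra].
  have dN0 : 0 < d / INR N.+1 by apply: Rdiv_lt_0_compat.
  have dN : d / INR N.+1 < rho by rewrite /Rdiv; nra.
  have [|j jlt|p [sp hp]] := @grid_poly n (d / INR N.+1) g (N.+1 * n.+1)%N; first lra.
    apply: hd; last by rewrite Rabs_pos_eq; lra.
    have j0 := pos_INR j.
    have : INR j < INR N.+1 * INR n.+1 by rewrite -mult_INR; apply: lt_INR; lia.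
    have -> : INR j * (d / INR N.+1) = (INR j * / INR N.+1) * d by rewrite /Rdiv; ring.
    move=> jN; have : INR j * / INR N.+1 < INR n.+1.
      apply: (Rmult_lt_reg_l (INR N.+1)) => //.
      by have -> : INR N.+1 * (INR j * / INR N.+1) = INR j by field; lra.
    have : 0 <= INR j * / INR N.+1 by apply: Rle_mult_inv_pos.
    by move=> ? ?; rewrite Rabs_pos_eq; nra.
  by exists p; split => // j jlt; apply: hp; lia.
have [p [sp hp]] := grid 0%N.
exists p, d; split => // x [x0 xd].
have {}hp N j : (j < N.+1 * n.+1)%N ->
    g (INR j * (d / INR N.+1)) = horner p (INR j * (d / INR N.+1)).
  have [q [sq hq]] := grid N.
  suff -> : p = q by exact: hq.
  apply: (@poly_eq_points R n (fun i => INR i * d)) => // [i j' ij|i ilt].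
    apply/eqP => e; have := Rmult_eq_reg_r _ _ _ e (Rgt_not_eq _ _ d0).
    by move/INR_eq; lia.
  have <- : INR i * (d / INR 1) = INR i * d by rewrite /=; field.
  rewrite -hp; last lia.
  have N0 : 0 < INR N.+1 by apply: lt_0_INR; lia.
  have -> : INR i * (d / INR 1) = INR (i * N.+1) * (d / INR N.+1).
    by rewrite mult_INR (_ : INR 1 = 1) //; field; lra.
  by apply: hq; nia.
(* The difference of [g] and [p] is continuous at [x] and vanishes on all the grids, whose points
   come arbitrarily close to [x]. *)
apply: Rminus_diag_uniq; apply: cond_eq => e e0.
have cont : continuity_pt (fun z => g z - horner p z) x.
  apply: continuity_pt_minus; last exact: continuity_horner.
  by apply: cg; rewrite Rabs_pos_eq; nra.
have [al [al0 hal]] := cont e e0.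
have [N [iN0 iN]] := @small_inv (al / d) ltac:(apply: Rdiv_lt_0_compat; lra).
have N0 : 0 < INR N.+1 by apply: lt_0_INR; lia.
pose s := d / INR N.+1.
have s0 : 0 < s by apply: Rdiv_lt_0_compat.
have sal : s < al.
  have -> : al = (al / d) * d by field; lra.
  by rewrite /s /Rdiv Rmult_comm; apply: Rmult_lt_compat_r.
have [up1 up2] := archimed (x / s).
have xs : 0 < x / s by apply: Rdiv_lt_0_compat.
have xs' : x / s < INR N.+1.
  apply: (Rmult_lt_reg_r s) => //.
  have -> : x / s * s = x by field; lra.
  by have -> : INR N.+1 * s = d by rewrite /s; field; lra.
have : (0 < up (x / s))%Z by apply: lt_IZR; lra.
move: (up (x / s)) up1 up2 => u up1 up2 u0.
pose j := Z.to_nat (u - 1).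
have jE : INR j = IZR u - 1 by rewrite INR_IZR_INZ -minus_IZR; congr IZR; lia.
have jN : (j < N.+1 * n.+1)%N.
  suff : (j < N.+1)%N by nia.
  by apply/ssrnat.ltP; apply: INR_lt; lra.
have close : Rabs (INR j * s - x) < al.
  have -> : INR j * s - x = - ((x / s - INR j) * s) by field; lra.
  rewrite Rabs_Ropp Rabs_mult !Rabs_pos_eq; [nra|lra|lra].
(* The limit in [continuity_pt] excludes the point itself, so a grid point equal to [x] is treated
   apart. *)
have [xj|xj] := Req_dec (INR j * s) x.
  by rewrite -xj hp // Rminus_diag Rminus_diag Rabs_R0.
have := hal (INR j * s); rewrite /= /Rdist hp // Rminus_diag => H.
rewrite Rminus_0_r -Rabs_Ropp -Rminus_0_l; apply: H; split => //; split => //.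
exact/not_eq_sym.
Qed.

(** * Generic points *)

Lemma nested_intervals (l h : nat -> R) : (forall n, l n <= l n.+1) ->
  (forall n, h n.+1 <= h n) -> (forall n, l n <= h n) -> exists x, forall n, l n <= x <= h n.
Proof.
move=> lm hm lh.
have lmono n m : (n <= m)%N -> l n <= l m.
  elim: m => [|m IH]; first by rewrite leqn0 => /eqP ->; lra.
  rewrite leq_eqVlt => /orP[/eqP ->|/IH]; first lra.
  by have := lm m; lra.
have hmono n m : (n <= m)%N -> h m <= h n.
  elim: m => [|m IH]; first by rewrite leqn0 => /eqP ->; lra.
  rewrite leq_eqVlt => /orP[/eqP ->|/IH]; first lra.
  by have := hm m; lra.
have lh2 n m : l n <= h m.
  have := lmono n (n + m)%N (leq_addr _ _); have := hmono m (n + m)%N (leq_addl _ _).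
  by have := lh (n + m)%N; lra.
have [|//|x [ub lub]] := completeness (fun y => exists n, y = l n).
- by exists (h 0%N) => y [n ->].
- by exists (l 0%N), 0%N.
exists x => n; split; first by apply: ub; exists n.
by apply: lub => y [m ->].
Qed.

(** Nested closed boxes, each chosen to avoid the next [P n], have a common point, found coordinate
    by coordinate. *)
Lemma baire_boxes (P : nat -> (nat -> R) -> Prop) (lo0 hi0 : nat -> R) :
  (forall i, lo0 i < hi0 i) ->
  (forall n lo hi, (forall i, lo0 i <= lo i < hi i /\ hi i <= hi0 i) ->
    exists lo' hi', (forall i, lo i < lo' i < hi' i /\ hi' i < hi i) /\
      forall p, (forall i, lo' i <= p i <= hi' i) -> ~ P n p) ->
  exists p, (forall i, lo0 i < p i < hi0 i) /\ forall n, ~ P n p.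
Proof.
move=> h0 step.
pose box := ((nat -> R) * (nat -> R))%type.
pose valid (b : box) := forall i, lo0 i <= b.1 i < b.2 i /\ b.2 i <= hi0 i.
(* Guarding by validity lets [choice] give a total function on boxes. *)
pose next (nb : nat * box) (b' : box) := valid nb.2 ->
  (forall i, nb.2.1 i < b'.1 i < b'.2 i /\ b'.2 i < nb.2.2 i) /\
  forall p, (forall i, b'.1 i <= p i <= b'.2 i) -> ~ P nb.1 p.
have /choice[nx hnx] : forall nb, exists b', next nb b'.
  move=> [n b].
  have [v|nv] := pselect (valid b); last by exists b.
  by have [lo' [hi' H]] := step n _ _ v; exists (lo', hi').
pose bx := fix bx n : box := if n is m.+1 then nx (m, bx m) else (lo0, hi0).
have vbx n : valid (bx n).
  elim: n => [|n IH] i; first by have := h0 i; simpl; lra.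
  by have [/(_ i) + _] := hnx (n, bx n) IH; have := IH i; simpl; lra.
have inc n i := proj1 (hnx (n, bx n) (vbx n)) i.
have /choice[p hp] : forall i, exists x, forall n, (bx n).1 i <= x <= (bx n).2 i.
  move=> i.
  apply: (nested_intervals (l := fun n => (bx n).1 i) (h := fun n => (bx n).2 i)) => n.
  - by have := inc n i; simpl; lra.
  - by have := inc n i; simpl; lra.
  - by have := vbx n i; lra.
exists p; split=> [i|n]; first by have := inc 0%N i; have := hp i 1%N; simpl; lra.
by apply: (proj2 (hnx (n, bx n) (vbx n))) => i; exact: (hp i n.+1).
Qed.

(* [p] encodes the triple (u, v, w); the index 0 is reserved for the period w. *)
Definition orbit_family (f : R -> R) (p : nat -> R) (k : nat) : R :=
  if k is 0%N then p 2%N else f (INR k * p 0%N + p 1%N).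

Definition relation_value (f : R -> R) (c : nat -> Z) (N : nat) (p : nat -> R) : R :=
  sum_f_R0 (fun k => IZR (c k) * orbit_family f p k) N.

(** A relation that fails at a point fails nearby, which provides the smaller box for
    [baire_boxes]. *)
Lemma relation_value_cont f c N p : (forall x, 0 < x -> continuity_pt f x) ->
  0 < p 0%N -> 0 < p 1%N -> forall eps, 0 < eps -> exists del, 0 < del /\
  forall p', (forall i, Rabs (p' i - p i) < del) ->
    Rabs (relation_value f c N p' - relation_value f c N p) < eps.
Proof.
move=> hf p0 p1.
have fam k eps : 0 < eps -> exists del, 0 < del /\
  forall p', (forall i, Rabs (p' i - p i) < del) ->
    Rabs (IZR (c k) * orbit_family f p' k - IZR (c k) * orbit_family f p k) < eps.
  move=> e0.
  suff [del [d0 hd]] : exists del, 0 < del /\ forall p', (forall i, Rabs (p' i - p i) < del) ->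
      Rabs (orbit_family f p' k - orbit_family f p k) < eps / (Rabs (IZR (c k)) + 1).
    exists del; split => // p' /hd; have := Rabs_pos (IZR (c k)) => c0 h.
    rewrite -Rmult_minus_distr_l Rabs_mult.
    move: (Rabs (orbit_family f p' k - orbit_family f p k))
      (Rabs_pos (orbit_family f p' k - orbit_family f p k)) h => z z0 h.
    have : (Rabs (IZR (c k)) + 1) * z < (Rabs (IZR (c k)) + 1) * (eps / (Rabs (IZR (c k)) + 1)).
      by apply: Rmult_lt_compat_l => //; lra.
    have -> : (Rabs (IZR (c k)) + 1) * (eps / (Rabs (IZR (c k)) + 1)) = eps by field; lra.
    lra.
  have e0' : 0 < eps / (Rabs (IZR (c k)) + 1).
    by apply: Rdiv_lt_0_compat => //; have := Rabs_pos (IZR (c k)); lra.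
  move: (eps / _) e0' => {e0}eps e0.
  case: k => [|k]; first by exists eps; split => // p'; apply.
  have x0 : 0 < INR k.+1 * p 0%N + p 1%N.
    have : 0 < INR k.+1 * p 0%N by apply: Rmult_lt_0_compat => //; apply: lt_0_INR; lia.
    lra.
  have [al [al0 hal]] := hf _ x0 eps e0.
  have k0 := pos_INR k.+1.
  exists (al / (INR k.+1 + 1)); split=> [|p' hp']; first by apply: Rdiv_lt_0_compat; lra.
  rewrite /orbit_family.
  set x := INR k.+1 * p 0%N + p 1%N in x0 hal *; set x' := INR k.+1 * p' 0%N + _.
  have [->|xx'] := Req_dec x' x; first by rewrite Rminus_diag Rabs_R0.
  apply: (hal x'); split; first by split => //; exact/not_eq_sym.
  rewrite /= /Rdist (_ : x' - x = INR k.+1 * (p' 0%N - p 0%N) + (p' 1%N - p 1%N)); last first.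
    by rewrite /x /x'; ring.
  apply: Rle_lt_trans (Rabs_triang _ _) _; rewrite Rabs_mult (Rabs_pos_eq (INR k.+1)) //.
  have := hp' 0%N; have := hp' 1%N; set del := al / _ => h1 h2.
  have -> : al = INR k.+1 * del + del by rewrite /del; field; lra.
  by have := Rmult_le_compat_l _ _ _ k0 (Rlt_le _ _ h2); lra.
elim: N => [|N IH] eps e0; first exact: fam.
have [d1 [d10 h1]] := IH (eps / 2) ltac:(lra).
have [d2 [d20 h2]] := fam N.+1 (eps / 2) ltac:(lra).
exists (Rmin d1 d2); split=> [|p' hp']; first exact: Rmin_glb_lt.
have H1 := h1 p' (fun i => Rlt_le_trans _ _ _ (hp' i) (Rmin_l _ _)).
have H2 := h2 p' (fun i => Rlt_le_trans _ _ _ (hp' i) (Rmin_r _ _)).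
rewrite /relation_value !tech5 -!/(relation_value f c N _).
have e (A B C D : R) : A + C - (B + D) = (A - B) + (C - D) by ring.
rewrite e.
apply: Rle_lt_trans (Rabs_triang _ _) _; lra.
Qed.

(* Only the constant term of the relation involves the coordinate [p 2], so its
   coefficient must vanish. *)
Lemma relation_polynomial f c N k0 (lo hi : nat -> R) : (forall x, 0 < x -> continuity_pt f x) ->
  (forall i, 0 < lo i < hi i) -> (k0 <= N)%N -> c k0 <> 0%Z ->
  (forall p, (forall i, lo i < p i < hi i) -> relation_value f c N p = 0) ->
  exists (a d : R) (q : {poly R}), 0 <= a /\ 0 < d /\ forall x, a < x < a + d -> f x = horner q x.
Proof.
move=> hf lh k0N ck0 rel0.
pose m i := (lo i + hi i) / 2.
pose rho := Rmin (m 0%N - lo 0%N) (Rmin (m 1%N - lo 1%N) (m 2%N - lo 2%N)).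
have [l0 [l1 l2]] : 0 < lo 0%N < hi 0%N /\ 0 < lo 1%N < hi 1%N /\ 0 < lo 2%N < hi 2%N by [].
have rho0 : 0 < rho by rewrite /rho /m; do 2 (apply: Rmin_glb_lt; first lra); lra.
have [r0 [r1 r2]] : rho <= m 0%N - lo 0%N /\ rho <= m 1%N - lo 1%N /\ rho <= m 2%N - lo 2%N.
  rewrite /rho; have := Rmin_l (m 0%N - lo 0%N) (Rmin (m 1%N - lo 1%N) (m 2%N - lo 2%N)).
  have := Rmin_r (m 0%N - lo 0%N) (Rmin (m 1%N - lo 1%N) (m 2%N - lo 2%N)).
  by have := Rmin_l (m 1%N - lo 1%N) (m 2%N - lo 2%N); have := Rmin_r (m 1%N - lo 1%N) (m 2%N - lo 2%N); lra.
pose pt s r w i := match i with 0%N => m 0%N + s | 1%N => m 1%N + r | 2%N => m 2%N + w | _ => m i end.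
have rel s r w : Rabs s < rho -> Rabs r < rho -> Rabs w < rho ->
    relation_value f c N (pt s r w) = 0.
  move=> /Rabs_def2 hs /Rabs_def2 hr /Rabs_def2 hw; apply: rel0 => -[|[|[|i]]] /=.
  - by move: r0; rewrite /m in hs *; lra.
  - by move: r1; rewrite /m in hr *; lra.
  - by move: r2; rewrite /m in hw *; lra.
  - by have := lh i.+3; rewrite /m; lra.
have z0 : Rabs 0 < rho by rewrite Rabs_R0.
have split0 g n : sum_f_R0 g n = g 0%N + sum_f_R0 (fun k => if k is 0%N then 0 else g k) n.
  by elim: n => [|n IH] /=; [ring | rewrite IH; ring].
have c0 : c 0%N = 0%Z.
  have z1 : Rabs (rho / 2) < rho by rewrite Rabs_pos_eq; lra.
  have := rel 0 0 0 z0 z0 z0; have := rel 0 0 (rho / 2) z0 z0 z1.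
  rewrite /relation_value split0 [X in _ -> X = 0 -> _]split0 /=.
  set S1 := sum_f_R0 _ _; set S2 := sum_f_R0 _ _.
  have -> : S1 = S2 by apply: PartSum.sum_eq => -[|k] _.
  by move=> h1 h2; apply: eq_IZR; nra.
pose x0 := INR k0 * m 0%N + m 1%N.
(* Absorbing the coefficient and the centre of the box turns the relation into the form treated by
   [iter_diff_eq0]. *)
pose g (k : nat) z := IZR (c k) * f (z + (INR k * m 0%N + m 1%N)).
pose js := rem k0 (iota 0 N.+1).
have k0js : k0 \notin js by rewrite mem_rem_uniq ?iota_uniq // !inE eqxx.
have [kap [kap0 hkap]] := iter_diff_eq0 k0js.
have diff0 := hkap rho N g rho0 k0N.
have m0 : 0 < m 0%N by rewrite /m; lra.
have m1 : 0 < m 1%N by rewrite /m; lra.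
have x00 : rho <= x0.
  have := Rmult_le_pos _ _ (pos_INR k0) (Rlt_le _ _ m0); rewrite /x0; lra.
have [|||p [d [d0 hp]]] := @iter_diff_eq0_poly (size js) (g k0) (Rmin rho (kap * rho)).
- by apply: Rmin_glb_lt => //; nra.
- move=> y h hy hh; apply: diff0.
  + move=> k kN; rewrite inE negb_or mem_rem_uniq ?iota_uniq // !inE mem_iota.
    by move=> /andP[->] /=; lia.
  + move=> s r hs hr; rewrite -[RHS](rel s r 0 hs hr z0); apply: PartSum.sum_eq => k _.
    case: k => [|k]; first by rewrite /g c0 !Rmult_0_l.
    by rewrite /g /orbit_family; congr (_ * f _); rewrite /pt; ring.
  + exact: Rlt_le_trans hy (Rmin_r _ _).
  + exact: Rlt_le_trans hh (Rmin_r _ _).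
- move=> y hy; apply: continuity_pt_scal.
  have /Rabs_def2 hy' : Rabs y < rho := Rlt_le_trans _ _ _ hy (Rmin_l _ _).
  apply: (continuity_pt_comp (fun z => z + (INR k0 * m 0%N + m 1%N)) f).
    by apply: derivable_continuous_pt; reg.
  by apply: hf; rewrite -/x0; lra.
have ck0' : IZR (c k0) <> 0 := not_0_IZR _ ck0.
exists x0, d, ((/ IZR (c k0)) *: (p \Po ('X - x0%:P)))%R; split; first lra.
split => // x hx.
rewrite hornerZ horner_comp hornerD hornerN hornerX hornerC -hp; last by change (0 < x - x0 < d); lra.
rewrite /g -/x0; change (f x = / IZR (c k0) * (IZR (c k0) * f (x - x0 + x0))).
by have -> : x - x0 + x0 = x by [ring]; field.
Qed.

(** Nontrivial integer relations are countable in number. Without a polynomial piece of [f] none of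
    them holds throughout a box, so each is avoided on a smaller box and Baire's theorem applies. *)
Lemma generic_rat_free (U V : R -> Prop) (f : R -> R)
  (hU0 : forall u, U u -> 0 < u) (hV0 : forall v, V v -> 0 < v)
  (hUo : open_set U) (hVo : open_set V)
  (hUne : exists u, U u) (hVne : exists v, V v)
  (hf : forall x, 0 < x -> continuity_pt f x) :
  (exists (a d : R) (q : {poly R}), 0 <= a /\ 0 < d /\ forall x, a < x < a + d -> f x = horner q x) \/
  exists p, U (p 0%N) /\ V (p 1%N) /\ forall n, rat_free (orbit_family f p) n.
Proof.
have [|nopoly] := pselect (exists (a d : R) (q : {poly R}), 0 <= a /\ 0 < d /\
  forall x, a < x < a + d -> f x = horner q x); first by left.
right.
have [u Uu] := hUne; have [v Vv] := hVne.
have [du hdu] := hUo u Uu; have [dv hdv] := hVo v Vv.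
have du0 := cond_pos du; have dv0 := cond_pos dv.
have inU x : u - du < x < u + du -> U x by move=> h; apply: hdu; apply: Rabs_def1; lra.
have inV x : v - dv < x < v + dv -> V x by move=> h; apply: hdv; apply: Rabs_def1; lra.
pose lo0 i := match i with 0%N => u - du / 2 | 1%N => v - dv / 2 | _ => 1 end.
pose hi0 i := match i with 0%N => u + du / 2 | 1%N => v + dv / 2 | _ => 2 end.
have lo0_gt0 i : 0 < lo0 i.
  by case: i => [|[|i]] /=; [apply: hU0; apply: inU| apply: hV0; apply: inV|]; lra.
(* Coding integers as differences of naturals makes relations enumerable by [unpickle]; the default
   pair gives coefficient 0 beyond the list. *)
pose coef (l : seq (nat * nat)) k : Z :=
  let x := nth (0%N, 0%N) l k in (Z.of_nat x.1 - Z.of_nat x.2)%Z.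
pose P n p := if unpickle n is Some (N, l) then
  (exists k, (k <= N)%N /\ coef l k <> 0%Z) /\ relation_value f (coef l) N p = 0 else False.
have [||p [hp hP]] := @baire_boxes P lo0 hi0.
- by case=> [|[|i]] /=; lra.
- move=> n lo hi box.
  have lohi i : 0 < lo i < hi i by have := box i; have := lo0_gt0 i; lra.
  have [p [hp [del [del0 hdel]]]] : exists p, (forall i, lo i < p i < hi i) /\
      exists del, 0 < del /\ forall p', (forall i, Rabs (p' i - p i) < del) -> ~ P n p'.
    pose mid i := (lo i + hi i) / 2.
    have hmid i : lo i < mid i < hi i by have := lohi i; rewrite /mid; lra.
    rewrite /P; case: (unpickle n) => [[N l]|]; last by exists mid; split => //; exists 1; split=> [|p' _]; [lra|].
    have [[k [kN ck]]|no] := pselect (exists k, (k <= N)%N /\ coef l k <> 0%Z); last first.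
      by exists mid; split => //; exists 1; split=> [|p' _ []]; [lra|].
    have [[p [hp np]]|all0] := pselect (exists p, (forall i, lo i < p i < hi i) /\
        relation_value f (coef l) N p <> 0); last first.
      case: nopoly; apply: (relation_polynomial hf lohi kN ck) => p hp.
      by apply: contrapT => np; apply: all0; exists p.
    exists p; split => //.
    have pos i : 0 < p i by have := hp i; have := lohi i; lra.
    have [del [d0 hd]] := relation_value_cont (coef l) N hf (pos 0%N) (pos 1%N) (Rabs_pos_lt _ np).
    exists del; split => // p' /hd h [_ e].
    by move: h; rewrite e Rminus_0_l Rabs_Ropp; lra.
  pose eta i := Rmin del (Rmin (p i - lo i) (hi i - p i)) / 2.
  have heta i : 0 < eta i /\ eta i < del /\ eta i < p i - lo i /\ eta i < hi i - p i.
    have [h1 h2] := hp i; rewrite /eta.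
    have m0 : 0 < Rmin del (Rmin (p i - lo i) (hi i - p i)) by do 2 (apply: Rmin_glb_lt; first lra); lra.
    have := Rmin_l del (Rmin (p i - lo i) (hi i - p i)).
    have := Rmin_r del (Rmin (p i - lo i) (hi i - p i)).
    by have := Rmin_l (p i - lo i) (hi i - p i); have := Rmin_r (p i - lo i) (hi i - p i); lra.
  exists (fun i => p i - eta i), (fun i => p i + eta i); split=> [i|p' hp'].
    by have := heta i; lra.
  by apply: hdel => i; apply: Rabs_def1; have := heta i; have := hp' i; lra.
exists p; split; first by apply: inU; have := hp 0%N; rewrite /=; lra.
split=> [|N c hc k kN]; first by apply: inV; have := hp 1%N; rewrite /=; lra.
apply: contrapT => ck.
pose l := mkseq (fun k => (Z.to_nat (c k), Z.to_nat (Z.opp (c k)))) N.+1.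
have cE j : (j <= N)%N -> coef l j = c j.
  by move=> jN; rewrite /coef nth_mkseq //=; lia.
apply: (hP (pickle (N, l))); rewrite /P pickleK; split.
  by exists k; split => //; rewrite cE.
rewrite -[RHS]hc; apply: PartSum.sum_eq => j jN; rewrite cE //; lia.
Qed.

Theorem theorem2 (U V : R -> Prop) (f : R -> R)
  (hU0 : forall u, U u -> 0 < u) (hV0 : forall v, V v -> 0 < v)
  (hUo : open_set U) (hVo : open_set V)
  (hUne : exists u, U u) (hVne : exists v, V v)
  (hf : forall x, 0 < x -> continuity_pt f x)
  (hG : forall u v, U u -> V v -> pointwise_good (fun k => f (INR k * u + v))) :
  exists a b : R, 0 <= a /\ a < b /\
    exists (n : nat) (c : nat -> R),
      forall x, a < x < b -> f x = sum_f_R0 (fun i => c i * x ^ i) n.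
Proof.
have [[a [d [q [a0 [d0 hq]]]]]|[p [Up [Vp free]]]] :=
  generic_rat_free hU0 hV0 hUo hVo hUne hVne hf.
  exists a, (a + d); split => //; split; first lra.
  exists (size q), (fun i => nth 0 q i) => x hx.
  by rewrite hq //; apply: horner_sum_f_R0.
(* Only index 0, which holds the period, differs from the given sequence. *)
by case: (rat_free_not_good free _ (hG _ _ Up Vp)) => -[].
Qed.
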